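(* Let $\mathcal{A}$ be a simple arrangement in $V=\mathbb{K}^\ell$ and let $V=X_0\supsetneq X_1\supsetneq\cdots\supsetneq X_\ell=\{0\}$ be a flag of $\mathcal{A}$ with $X_i\in L_i(\mathcal{A})$. Suppose that $X_{i+1}$ is heavy in $(\mathcal{A}^{X_i},m^{X_i})$ for $i=1,\dots,\ell-1$. Then $\mathcal{A}$ is free with $\exp(\mathcal{A})=(m^{X_0}(X_1),m^{X_1}(X_2),\dots,m^{X_{\ell-1}}(X_\ell))$ if and only if $$b_2(\mathcal{A})=\sum_{0\le i<j\le\ell-1}m^{X_i}(X_{i+1})\,m^{X_j}(X_{j+1}).$$
   Context: Let $\mathbb{K}$ be a field, $V=\mathbb{K}^\ell$ and $S=\mathbb{K}[x_1,\dots,x_\ell]$. A (simple) arrangement $\mathcal{A}$ is a finite set of linear hyperplanes $H=\ker\alpha_H$ in $V$. A multiarrangement $(\mathcal{A},m)$ carries a multiplicity $m:\mathcal{A}\to\mathbb{Z}_{>0}$, with $|m|=\sum_Hm(H)$; a simple arrangement is the case $m\equiv1$. $L_k(\mathcal{A})$ is the set of codimension-$k$ intersections of hyperplanes of $\mathcal{A}$. $\mathcal{A}$ is free if $D(\mathcal{A})=\{\theta\in\mathrm{Der}_{\mathbb{K}}(S):\theta(\alpha_H)\in\alpha_HS\ \forall H\}$ is a free $S$-module. Its exponents are the polynomial degrees of a homogeneous basis. $b_2(\mathcal{A})$ is the coefficient of $t^{\ell-2}$ in the characteristic polynomial of $\mathcal{A}$; equivalently $b_2(\mathcal{A})=\sum_{X\in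 L_2(\mathcal{A})}(|\mathcal{A}_X|-1)$, where $\mathcal{A}_X=\{H\in\mathcal{A}:X\subseteq H\}$. Iterated restrictions: set $(\mathcal{A}^{X_0},m^{X_0})=(\mathcal{A},1)$. For $i\ge1$, $\mathcal{A}^{X_i}=\{X_i\cap Z: Z\in\mathcal{A}^{X_{i-1}},\ X_i\not\subseteq Z\}$, an arrangement in $X_i$ which requires $X_i\in\mathcal{A}^{X_{i-1}}$. Its multiplicity is $m^{X_i}(Y)=\sum_{Z\in\mathcal{A}^{X_{i-1}},\ Z\supseteq Y,\ Z\ne X_i}m^{X_{i-1}}(Z)$ for $Y\in\mathcal{A}^{X_i}$. A hyperplane $X$ of a multiarrangement $(\mathcal{B},n)$ is heavy if $2n(X)\ge|n|$. *)

(* Defs.v *)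
From HB Require Import structures.
From mathcomp Require Import all_boot all_order all_algebra.
From mathcomp Require Import mpoly.
Set Implicit Arguments. Unset Strict Implicit. Unset Printing Implicit Defensive.
Import GRing.Theory.
Local Open Scope ring_scope.

Section Arr.
Variables (K : fieldType) (l : nat).
Local Notation V := 'rV[K]_l.
Local Notation subsp := {vspace V}.
Local Notation S := {mpoly K[l]}.

Definition kerform (alpha : V) : subsp :=
  lker (linfun (mulmxr alpha^T : V -> 'M[K]_(1,1))).

Definition is_hyperplane (H : subsp) : bool := (\dim H).+1 == l.

Definition is_arrangement (A : seq subsp) : bool :=
  uniq A && all is_hyperplane A.

Definition linpoly (alpha : V) : S := \sum_(j < l) (alpha 0 j)%:MP * 'X_j.

(* a derivation theta = sum_j theta_j d/dx_j is given by its coefficients;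
   theta(alpha) = sum_j alpha_j theta_j for a linear form alpha *)
Definition der_apply (theta : 'I_l -> S) (alpha : V) : S :=
  \sum_(j < l) alpha 0 j *: theta j.

Definition in_D (A : seq subsp) (theta : 'I_l -> S) : Prop :=
  forall H, H \in A -> forall alpha : V, kerform alpha = H ->
    exists g : S, der_apply theta alpha = linpoly alpha * g.

Definition free_with_exp (A : seq subsp) (d : 'I_l -> nat) : Prop :=
  exists theta : 'I_l -> 'I_l -> S,
    [/\ forall i, in_D A (theta i),
        forall i j, theta i j \is ishomog1 (d i) mdeg,
        forall phi, in_D A phi ->
          exists f : 'I_l -> S, forall j, phi j = \sum_(i < l) f i * theta i j
      & forall f : 'I_l -> S, (forall j, \sum_(i < l) f i * theta i j = 0) ->
          forall i, f i = 0].

Definition capA (A : seq subsp) (I : {set 'I_(size A)}) : subsp :=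
  (\bigcap_(i in I) nth 0%VS A i)%VS.

Definition Lk (k : nat) (A : seq subsp) : seq subsp :=
  undup [seq capA J | J <- enum {set 'I_(size A)} & (\dim (capA J) == l - k)%N].

Definition b2 (A : seq subsp) : nat :=
  (\sum_(X <- Lk 2 A) (count (fun H => (X <= H)%VS) A - 1))%N.

(* multiarrangements: a list of subspaces (hyperplanes of some X) with
   multiplicity *)
Definition multiarr := (seq subsp * (subsp -> nat))%type.

Definition restrict_step (Bn : multiarr) (Xi : subsp) : multiarr :=
  let: (B, n) := Bn in
  (undup [seq (Xi :&: Z)%VS | Z <- B & ~~ (Xi <= Z)%VS],
   fun Y => (\sum_(Z <- B | (Y <= Z)%VS && (Z != Xi)) n Z)%N).

Fixpoint iter_restr (A : seq subsp) (X : nat -> subsp) (i : nat) : multiarr :=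
  match i with
  | 0 => (A, fun _ => 1%N)
  | i'.+1 => restrict_step (iter_restr A X i') (X i'.+1)
  end.

Definition mult_total (Bn : multiarr) : nat := (\sum_(Y <- Bn.1) Bn.2 Y)%N.

Definition heavy (Bn : multiarr) (X : subsp) : bool :=
  (mult_total Bn <= 2 * Bn.2 X)%N.

Definition is_flag (A : seq subsp) (X : nat -> subsp) : Prop :=
  [/\ X 0%N = fullv, X l = 0%VS,
      forall i, (i <= l)%N -> X i \in Lk i A
    & forall i, (i < l)%N -> (X i.+1 <= X i)%VS && (X i.+1 != X i)].

End Arr.

(* Main.v *)
Require Import Defs.
From HB Require Import structures.
From mathcomp Require Import all_boot all_order all_algebra.
From mathcomp Require Import mpoly.
From mathcomp Require Import perm ring.
Set Implicit Arguments. Unset Strict Implicit. Unset Printing Implicit Defensive.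
Import GRing.Theory.

(* Induction gives m^{X_i}(Y) = #{H in A : Y <= H, X_i not <= H}; hence
   n_i := m^{X_i}(X_{i+1}) is the number of hyperplanes of level i, i.e. of those
   containing X_{i+1} but not X_i, and heaviness yields n_1 >= n_2 >= ...

   Counting pairs of hyperplanes of distinct levels through each X in L_2 shows
   b_2(A) >= sum_{i<j} n_i n_j, with equality iff the flag is modular: for H <> H'
   of the same level j, some hyperplane of level < j contains H :&: H' (no X in
   L_2 is "flat").  So the theorem is: A is free with exponents (n_i) iff the flag
   is modular.

   Pick v_j in X_j outside X_{j+1}.
   - If the flag is modular, hyperplanes are added level by level.  At level j, one
     basis element is (product of the forms already added) v_j, and modularity
     makes every logarithmic theta satisfy theta(a) in (a, product of the forms
     already added) for the next form a, so the other basis elements can be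
     corrected by multiples of that one.
   - If A is free with exponents (n_i), levels are peeled off from the top.  With
     R the product of the n_j forms of the top level j, R v_j is logarithmic of
     degree n_j; since n_j is minimal among n_1, ..., n_j, it can replace a basis
     element, and then v_j replaces it in a basis for the lower levels (Saito).
     Applying such a basis to Q w, where Q defines the lower levels and w is
     constant, gives a - b | Q for any two normalized forms a, b of level j, which
     is modularity. *)

Section LinearForms.
Local Open Scope ring_scope.
Variables (K : fieldType) (l : nat).
Local Notation V := 'rV[K]_l.
Local Notation S := {mpoly K[l]}.
Implicit Types (a b : V) (f g h q : S) (t u : 'rV[S]_l) (M : 'M[S]_l).
Implicit Types (s F G P B : seq V).

(** * Homogeneous components and divisibility by one linear form *)

Lemma pihomogM (n d : nat) f g : f \is n.-homog ->
  pihomog mdeg d (f * g)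
  = if (n <= d)%N then f * pihomog mdeg (d - n) g else 0.
Proof.
move=> hf; rewrite [in LHS](pihomog_partitionE (leqnn (mmeasure mdeg g))).
rewrite mulr_sumr raddf_sum /=.
have hom e : f * pihomog mdeg e g \is (n + e).-homog.
  by apply: dhomogM => //; apply: pihomogP.
case: ifP => [le_nd|/negbT]; last first.
  rewrite -ltnNge => lt_dn; apply: big1 => e _.
  by apply: (pihomog_ne0 _ (hom e)); rewrite gtn_eqF // ltn_addr.
rewrite [in RHS](pihomog_partitionE (leqnn (mmeasure mdeg g))).
rewrite raddf_sum mulr_sumr /=; apply: eq_bigr => e _.
have [eq_d|ne_d] := eqVneq (n + e)%N d.
  by rewrite -eq_d addKn (pihomog_dE (hom e)) (pihomog_dE (pihomogP _ _ _)).
rewrite (pihomog_ne0 ne_d (hom e)) (pihomog_ne0 _ (pihomogP _ _ _)) ?mulr0 //.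
by apply: contra ne_d => /eqP ->; rewrite subnKC.
Qed.

(** In degree d the shift formula reads [f * g = f * pihomog mdeg (d - n) g], and f cancels because
    S is a domain. For d < n that component is zero, against [g != 0]. *)
Lemma dhomog_divl (n d : nat) f g :
  f \is n.-homog -> f != 0 -> f * g \is d.-homog -> g != 0 ->
  (n <= d)%N /\ g \is (d - n).-homog.
Proof.
move=> hf nz_f hfg nz_g; have := pihomogM d g hf.
rewrite (pihomog_dE hfg); case: ifP => [_ /(mulfI nz_f) -> | _ /eqP].
  by split=> //; apply: pihomogP.
by rewrite mulf_eq0 (negbTE nz_f) (negbTE nz_g).
Qed.

Lemma dhomog0_const f : f \is 0.-homog -> exists c, f = c%:MP.
Proof.
move=> /dhomogP hf; exists f@_0; apply: msize1_polyC.
rewrite (mmeasureE mdeg); apply/bigmax_leqP_seq => m m_f _.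
by rewrite (hf m m_f).
Qed.

Lemma dhomog_const c : (c%:MP : S) \is 0.-homog.
Proof. by rewrite -[c%:MP]mulr1 mul_mpolyC; apply/dhomogZ/dhomog1. Qed.

Definition dot a b : K := (a *m b^T) 0 0.

Lemma dotE a b : dot a b = \sum_j a 0 j * b 0 j.
Proof. by rewrite /dot mxE; apply: eq_bigr => j _; rewrite mxE. Qed.

Lemma dotZl c a b : dot (c *: a) b = c * dot a b.
Proof. by rewrite /dot -scalemxAl mxE. Qed.
Lemma dotBl a a' b : dot (a - a') b = dot a b - dot a' b.
Proof. by rewrite /dot mulmxBl !mxE. Qed.
Lemma dotC a b : dot a b = dot b a.
Proof. by rewrite !dotE; apply: eq_bigr => j _; rewrite mulrC. Qed.

Lemma linpoly_linear : linear (@linpoly K l).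
Proof.
move=> c a b; rewrite /linpoly scaler_sumr -big_split /=.
apply: eq_bigr => j _; rewrite !mxE -mul_mpolyC mpolyCD mpolyCM; ring.
Qed.

HB.instance Definition _ :=
  GRing.isLinear.Build K V S _ (@linpoly K l) linpoly_linear.

Lemma linpoly_coeff a (i : 'I_l) : (linpoly a)@_U_(i) = a 0 i.
Proof.
rewrite /linpoly raddf_sum /= (bigD1 i) //= mul_mpolyC mcoeffZ mcoeffX eqxx.
rewrite mulr1 big1 ?addr0 // => j ne_ji.
by rewrite mul_mpolyC mcoeffZ mcoeffX eq_mnm1 (negbTE ne_ji) mulr0.
Qed.

Lemma linpoly_inj : injective (@linpoly K l).
Proof.
move=> a b eq_ab; apply/rowP => i.
by rewrite -!linpoly_coeff eq_ab.
Qed.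

Lemma linpoly_eq0 a : (linpoly a == 0) = (a == 0).
Proof. by rewrite -(inj_eq linpoly_inj) raddf0. Qed.

Lemma linpoly_homog a : linpoly a \is 1.-homog.
Proof.
apply: rpred_sum => j _; rewrite mul_mpolyC; apply: dhomogZ.
by rewrite dhomogX /= mdeg1.
Qed.

Definition ldvd a f := exists g, f = linpoly a * g.

Lemma ldvdD a f g : ldvd a f -> ldvd a g -> ldvd a (f + g).
Proof. by move=> [u ->] [w ->]; exists (u + w); rewrite mulrDr. Qed.

Lemma ldvdMr a f g : ldvd a f -> ldvd a (f * g).
Proof. by move=> [u ->]; exists (u * g); rewrite mulrA. Qed.

Lemma ldvdMl a f g : ldvd a g -> ldvd a (f * g).
Proof. by rewrite mulrC; apply: ldvdMr. Qed.

Lemma ldvdB a f g : ldvd a f -> ldvd a g -> ldvd a (f - g).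
Proof. by move=> [u ->] [w ->]; exists (u - w); rewrite mulrBr. Qed.

Lemma ldvd0 a : ldvd a 0.
Proof. by exists 0; rewrite mulr0. Qed.

Lemma ldvd_sum a (I : eqType) (r : seq I) (P : pred I) (F : I -> S) :
  (forall i, i \in r -> P i -> ldvd a (F i)) -> ldvd a (\sum_(i <- r | P i) F i).
Proof.
move=> dvdF; rewrite big_seq_cond.
elim/big_rec: _ => [|i f /andP[r_i P_i] dvd_f]; first exact: ldvd0.
by apply: ldvdD => //; apply: dvdF.
Qed.

(** The quotient of two forms of degree 1 is homogeneous of degree 0, hence constant. *)
Lemma ldvd_linpoly a b : a != 0 -> ldvd a (linpoly b) -> exists c, b = c *: a.
Proof.
move=> nz_a [g def_b]; have [g0|nz_g] := eqVneq g 0.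
  exists 0; rewrite scale0r; apply/eqP.
  by rewrite -linpoly_eq0 def_b g0 mulr0.
have hb := linpoly_homog b; rewrite def_b in hb.
have [|_ /dhomog0_const[c def_g]] := dhomog_divl (linpoly_homog a) _ hb nz_g.
  by rewrite linpoly_eq0.
exists c; apply: linpoly_inj.
by rewrite def_b def_g mulrC mul_mpolyC linearZ.
Qed.

(* Restriction of polynomials to the hyperplane [dot a = 0], seen as the image
   of the projection [x |-> x - a(x) v] along [v], where [dot a v = 1]. *)
Definition hrestr a (v : V) f : S :=
  f \mPo [tuple 'X_i - (v 0 i)%:MP * linpoly a | i < l].

HB.instance Definition _ a v := GRing.RMorphism.copy (hrestr a v)
  (comp_mpoly [tuple 'X_i - (v 0 i)%:MP * linpoly a | i < l]).

Lemma hrestrC a v c : hrestr a v c%:MP = c%:MP.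
Proof. exact: comp_mpolyC. Qed.

Lemma hrestr_prod a v s (P : pred V) (E : V -> S) :
  hrestr a v (\prod_(b <- s | P b) E b) = \prod_(b <- s | P b) hrestr a v (E b).
Proof. exact: (big_morph (hrestr a v) (rmorphM _) (rmorph1 _)). Qed.

Lemma hrestr_linpoly a v b : hrestr a v (linpoly b) = linpoly (b - dot b v *: a).
Proof.
rewrite {1}/linpoly rmorph_sum /= linearB linearZ /= -mul_mpolyC dotE rmorph_sum.
rewrite mulr_suml -sumrB; apply: eq_bigr => j _.
rewrite rmorphM /= hrestrC /hrestr comp_mpolyXU -tnth_nth tnth_mktuple /= mpolyCM.
ring.
Qed.

(** For a variable the difference is v_i a. The property passes to sums, and to powers and products
    by x y - x' y' = (x - x') y + x' (y - y'). *)
Lemma hrestr_mod a v f : ldvd a (f - hrestr a v f).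
Proof.
elim/mpolyind: f => [|c m f _ _ IHf]; first by rewrite rmorph0 subr0; apply: ldvd0.
rewrite rmorphD opprD addrACA; apply: ldvdD => //.
rewrite -mul_mpolyC rmorphM /= hrestrC -mulrBr; apply: ldvdMl.
rewrite mpolyXE_id rmorph_prod /=.
elim/big_rec2: _ => [|i f' f'' _ IH]; first by rewrite subrr; apply: ldvd0.
set x := _ ^+ _; set y := hrestr a v x.
have ->: x * f'' - y * f' = (x - y) * f'' + y * (f'' - f') by ring.
apply: ldvdD; last exact: ldvdMl.
apply: ldvdMr; rewrite {}/y {}/x.
elim: (m i) => [|k IHk]; first by rewrite !expr0 rmorph1 subrr; apply: ldvd0.
rewrite !exprS rmorphM; set x := _ ^+ _.
have ->: 'X_i * x - hrestr a v 'X_i * hrestr a v x =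
  ('X_i - hrestr a v 'X_i) * x + hrestr a v 'X_i * (x - hrestr a v x) by ring.
apply: ldvdD; last exact: ldvdMl.
apply: ldvdMr; rewrite /hrestr comp_mpolyXU -tnth_nth tnth_mktuple.
by exists (v 0 i)%:MP; ring.
Qed.

Lemma hrestr_eq0 a v f : dot a v = 1 -> ldvd a f <-> hrestr a v f = 0.
Proof.
move=> av1; split=> [[g ->]|f0].
  by rewrite rmorphM /= hrestr_linpoly av1 scale1r subrr raddf0 mul0r.
by rewrite -[f]subr0 -f0; apply: hrestr_mod.
Qed.

Lemma dot_dual a : a != 0 -> exists v, dot a v = 1.
Proof.
case/rV0Pn => i nz; exists ((a 0 i)^-1 *: delta_mx 0 i).
rewrite dotE (bigD1 i) //= big1 ?addr0; first by rewrite !mxE !eqxx mulr1 mulfV.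
by move=> j ne_ji; rewrite !mxE (negbTE ne_ji) andbF !mulr0.
Qed.

(** The ideal generated by a is the kernel of [hrestr a v], a ring morphism into a domain. *)
Lemma ldvd_prime a f g : a != 0 -> ldvd a (f * g) -> ldvd a f \/ ldvd a g.
Proof.
move=> /dot_dual[v av1] /(hrestr_eq0 _ av1)/eqP.
rewrite rmorphM mulf_eq0 => /orP[] /eqP f0.
  by left; apply/(hrestr_eq0 _ av1).
by right; apply/(hrestr_eq0 _ av1).
Qed.

Lemma ldvd_unit a : a != 0 -> ~ ldvd a 1.
Proof.
move=> /dot_dual[v av1] /(hrestr_eq0 _ av1) /eqP.
by rewrite rmorph1 oner_eq0.
Qed.

Lemma ldvd_constM a c f : c != 0 -> ldvd a (f * c%:MP) -> ldvd a f.
Proof.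
move=> nz_c [g def_f]; exists (g * c^-1%:MP).
by rewrite mulrA -def_f -mulrA -mpolyCM mulfV // mpolyC1 mulr1.
Qed.

Lemma ldvd_prime_prod a (s : seq V) : a != 0 ->
  ldvd a (\prod_(b <- s) linpoly b) ->
  exists2 b, b \in s & ldvd a (linpoly b).
Proof.
move=> nz_a; elim: s => [|b s IHs]; first by rewrite big_nil => /(ldvd_unit nz_a).
rewrite big_cons => /(ldvd_prime nz_a)[dvd_b|/IHs[c s_c dvd_c]].
  by exists b; rewrite ?mem_head.
by exists c; rewrite // inE s_c orbT.
Qed.

(** * Divisibility by products of linear forms *)

Definition pdvd (f g : S) := exists h, g = f * h.

Lemma pdvd_coprime (s : seq V) f g :
  (forall a, a \in s -> a != 0 /\ ~ ldvd a f) ->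
  pdvd (\prod_(a <- s) linpoly a) (f * g) -> pdvd (\prod_(a <- s) linpoly a) g.
Proof.
elim: s g => [|a s IHs] g cop; first by exists g; rewrite big_nil mul1r.
rewrite big_cons => -[h def_fg].
have [nz_a ndvd_a] := cop a (mem_head _ _).
have [|//|[g' def_g]] := @ldvd_prime a f g nz_a.
  by exists (\prod_(j <- s) linpoly j * h); rewrite mulrA.
have [|h' def_g'] := IHs g' (fun b s_b => cop b (@mem_behead _ (a :: s) b s_b)).
  exists h; apply: (mulfI (x := linpoly a)); first by rewrite linpoly_eq0.
  by rewrite mulrCA -def_g def_fg mulrA.
by exists h'; rewrite def_g def_g' mulrA.
Qed.

(** The list may contain proportional forms, as happens after restriction to a hyperplane, so
    divisibility is tested on whole proportionality classes. Distinct classes are coprime: the class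
    of the head is split off and the induction runs on the rest. *)
Lemma pdvd_classes (s : seq V) f :
    (forall a, a \in s -> a != 0) ->
    (forall a, a \in s ->
       pdvd (\prod_(b <- s | (b <= a)%MS) linpoly b) f) ->
  pdvd (\prod_(a <- s) linpoly a) f.
Proof.
have [n] := ubnP (size s); elim: n s => // n IHn [|a s] /=.
  by move=> *; exists f; rewrite big_nil mul1r.
rewrite ltnS => le_sn nz_s cls_s.
set t := a :: s in nz_s cls_s *.
pose t1 := [seq b <- t | (b <= a)%MS]; pose t2 := [seq b <- t | ~~ (b <= a)%MS].
have sub_t2 b : b \in t2 -> (b \in t) && ~~ (b <= a)%MS.
  by rewrite mem_filter andbC.
have [|||f2 def_f] := IHn t2.
- rewrite /t2 /t /= submx_refl /=.
  by apply: leq_ltn_trans le_sn; rewrite size_filter count_size.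
- by move=> b /sub_t2/andP[t_b _]; apply: nz_s.
- move=> b /sub_t2/andP[t_b _]; have [h ->] := cls_s b t_b.
  exists ((\prod_(c <- t | (c <= b)%MS && (c <= a)%MS) linpoly c) * h).
  rewrite big_filter_cond (bigID (fun c => (c <= a)%MS)) /= mulrCA mulrA.
  by congr (_ * _ * _); apply: eq_bigl => c; rewrite andbC.
have [||h def_f2] := pdvd_coprime (s := t1) (f := \prod_(b <- t2) linpoly b) (g := f2).
- move=> b; rewrite mem_filter => /andP[ba t_b]; split; first exact: nz_s.
  have nz_b := nz_s b t_b; case/(ldvd_prime_prod nz_b) => c /sub_t2/andP[_ nca].
  case/(ldvd_linpoly nz_b) => k def_c; case/negP: nca; rewrite def_c.
  exact: scalemx_sub.
- rewrite -def_f /t1 big_filter; apply: cls_s; exact: mem_head.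
exists h; rewrite def_f def_f2 mulrA; congr (_ * _).
by rewrite [RHS](bigID (fun c => (c <= a)%MS)) /= mulrC /t1 /t2 !big_filter.
Qed.

(** For row vectors [(b <= a)%MS] means that b is a multiple of a, so distinct members of F define
    distinct hyperplanes. *)
Definition simple_forms (F : seq V) :=
  [/\ uniq F, forall a, a \in F -> a != 0
    & forall a b, a \in F -> b \in F -> (b <= a)%MS -> b = a].

Definition defpoly (F : seq V) : S := \prod_(a <- F) linpoly a.

Lemma simple_forms_sub (F G : seq V) :
  uniq G -> {subset G <= F} -> simple_forms F -> simple_forms G.
Proof.
move=> uG sGF [_ nzF prF]; split=> // [a /sGF/nzF //|a b /sGF Fa /sGF Fb].
exact: prF.
Qed.

Lemma defpoly_neq0 F : simple_forms F -> defpoly F != 0.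
Proof.
case=> _ nzF _; rewrite /defpoly big_seq prodf_seq_neq0.
by apply/allP => a F_a; rewrite F_a linpoly_eq0 nzF.
Qed.

Lemma defpoly_homog F : defpoly F \is (size F).-homog.
Proof.
rewrite /defpoly; elim: F => [|a F IHF]; first by rewrite big_nil dhomog1.
by rewrite big_cons; apply: (dhomogM (linpoly_homog a) IHF).
Qed.

Lemma defpoly_cat F G : defpoly (F ++ G) = defpoly F * defpoly G.
Proof. by rewrite /defpoly big_cat. Qed.

Lemma ldvd_defpoly F a : a \in F -> ldvd a (defpoly F).
Proof.
by move=> F_a; exists (\prod_(b <- rem a F) linpoly b); rewrite /defpoly (big_rem a).
Qed.

Lemma defpoly_dvd F f :
  simple_forms F -> (forall a, a \in F -> ldvd a f) -> pdvd (defpoly F) f.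
Proof.
move=> [uF nzF prF] dvdF; apply: pdvd_classes => // a F_a.
have [g ->] := dvdF a F_a; exists g; congr (_ * _).
rewrite (big_rem a) //= submx_refl big1_seq ?mulr1 // => b /andP[ba].
by rewrite mem_rem_uniq // inE => /andP[/eqP nba Fb]; case: nba; apply: prF.
Qed.

(** * Logarithmic derivations and Saito's criterion *)

(** The same constant row serves as a constant vector field and as the coefficients of a linear form
    to which derivations are applied. *)
Definition cst a : 'rV[S]_l := map_mx (@mpolyC l K) a.

Definition der (t : 'rV[S]_l) a : S := (t *m (cst a)^T) 0 0.

Lemma der_applyE (t : 'rV[S]_l) a : der_apply (t 0) a = der t a.
Proof.
by rewrite /der mxE; apply: eq_bigr => j _; rewrite !mxE mulrC mul_mpolyC.
Qed.

Lemma cstB a b : cst (a - b) = cst a - cst b. Proof. exact: map_mxB. Qed.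
Lemma cstZ c a : cst (c *: a) = c%:MP *: cst a. Proof. exact: map_mxZ. Qed.

Lemma derB t a b : der t (a - b) = der t a - der t b.
Proof. by rewrite /der cstB linearB /= mulmxBr !mxE. Qed.
Lemma derZ t c a : der t (c *: a) = c%:MP * der t a.
Proof. by rewrite /der cstZ linearZ /= -scalemxAr mxE. Qed.
Lemma derDl t u a : der (t + u) a = der t a + der u a.
Proof. by rewrite /der mulmxDl mxE. Qed.
Lemma derZl f t a : der (f *: t) a = f * der t a.
Proof. by rewrite /der -scalemxAl mxE. Qed.
Lemma der_cst v a : der (cst v) a = (dot a v)%:MP.
Proof.
rewrite /der mxE dotC dotE raddf_sum; apply: eq_bigr => j _.
by rewrite !mxE -mpolyCM.
Qed.
Lemma der_mul t (M : 'M[S]_l) a : der (t *m M) a = \sum_i t 0 i * der (row i M) a.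
Proof.
rewrite /der -mulmxA mxE; apply: eq_bigr => i _.
by rewrite -row_mul [row _ _ 0 0]mxE.
Qed.

Lemma der_homog (t : 'rV[S]_l) d a :
  (forall j, t 0 j \is d.-homog) -> der t a \is d.-homog.
Proof.
move=> ht; rewrite -der_applyE; apply: rpred_sum => j _.
by apply: dhomogZ; apply: ht.
Qed.

Definition logder (F : seq V) (t : 'rV[S]_l) :=
  forall a, a \in F -> ldvd a (der t a).

Lemma logder_sub (F G : seq V) t : {subset G <= F} -> logder F t -> logder G t.
Proof. by move=> sGF Ft a /sGF; apply: Ft. Qed.

Lemma logder_defpoly F t : logder F (defpoly F *: t).
Proof. by move=> a Fa; rewrite derZl; apply: ldvdMr; apply: ldvd_defpoly. Qed.

Definition setrow (i : 'I_l) (t : 'rV[S]_l) (M : 'M[S]_l) : 'M[S]_l :=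
  \matrix_(k, j) if k == i then t 0 j else M k j.

Lemma row_setrow i k t M : row k (setrow i t M) = if k == i then t else row k M.
Proof. by apply/rowP => j; rewrite !mxE; case: ifP; rewrite ?mxE. Qed.

(** Laplace expansion along row i: its cofactors do not see the replaced row. *)
Lemma det_setrow i t M : \det (setrow i t M) = (t *m \adj M) 0 i.
Proof.
rewrite (expand_det_row _ i) mxE; apply: eq_bigr => j _.
rewrite [setrow _ _ _ _ _]mxE eqxx [(\adj M) _ _]mxE; congr (_ * (_ * \det _)).
by apply/matrixP => k k'; rewrite !mxE eq_sym (negbTE (neq_lift _ _)).
Qed.

Lemma det_setrow_comb i t M : \det (setrow i (t *m M) M) = t 0 i * \det M.
Proof. by rewrite det_setrow -mulmxA mul_mx_adj mul_mx_scalar mxE mulrC. Qed.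

Lemma det_setrowZ i f t M :
  \det (setrow i (f *: t) M) = f * \det (setrow i t M).
Proof. by rewrite !det_setrow -scalemxAl mxE. Qed.

(** M times the coefficient column of a is divisible by the form a. Multiplying by the adjugate, so
    is [\det M] times each coordinate of a, one of which is nonzero. *)
Lemma logder_det F a (M : 'M[S]_l) : a != 0 -> a \in F ->
  (forall i, logder F (row i M)) -> ldvd a (\det M).
Proof.
move=> nz_a Fa FM.
have [g def_g] := fin_all_exists (fun i => FM i a Fa).
have eqM : M *m (cst a)^T = linpoly a *: (\col_i g i).
  apply/colP => i; rewrite !mxE -def_g /der !mxE; apply: eq_bigr => j _.
  by rewrite !mxE.
case/rV0Pn: (nz_a) => i nz_ai; apply: (ldvd_constM nz_ai).
have := congr1 (fun N => (\adj M *m N) i 0) eqM.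
rewrite mulmxA mul_adj_mx mul_scalar_mx -scalemxAr [LHS]mxE [RHS]mxE => eq_i.
by exists ((\adj M *m \col_i g i) i 0); rewrite -eq_i !mxE.
Qed.

(** Saito's criterion, taken as the working notion of a basis: [saito_span] and [saito_indep]
    recover generation and independence. *)
Definition saito (F : seq V) (M : 'M[S]_l) :=
  (forall i, logder F (row i M))
  /\ exists2 c : K, c != 0 & \det M = c%:MP * defpoly F.

Lemma saito_det_neq0 F M : simple_forms F -> saito F M -> \det M != 0.
Proof.
move=> /defpoly_neq0 nzQ [_ [c nz_c ->]].
by rewrite mulf_neq0 // mpolyC_eq0.
Qed.

Lemma saito_indep F M t : simple_forms F -> saito F M -> t *m M = 0 -> t = 0.
Proof.
move=> sF /(saito_det_neq0 sF) nz_det tM0; apply/eqP.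
have: \det M *: t == 0 by rewrite -mul_mx_scalar -mul_mx_adj mulmxA tM0 mul0mx.
by rewrite scalemx_eq0 (negbTE nz_det).
Qed.

(** Cramer's rule: coordinate i of t is the determinant of M with row i replaced by t, divided by
    [\det M]. Every form of F divides this numerator, hence so does their product. *)
Lemma saito_span F M t : simple_forms F -> saito F M -> logder F t ->
  exists u, t = u *m M.
Proof.
move=> sF sM Ft; have [FM [c nz_c detM]] := sM.
have dvdQ i : pdvd (defpoly F) ((t *m \adj M) 0 i).
  apply: defpoly_dvd => // a Fa; rewrite -det_setrow.
  apply: (logder_det (F := F)) => //; first by case: sF => _ /(_ a Fa).
  by move=> k; rewrite row_setrow; case: ifP => // _; apply: FM.
have [u def_u] := fin_all_exists dvdQ.
have nzQ := defpoly_neq0 sF.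
have eq_t : c%:MP *: t = (\row_i u i) *m M.
  have: t *m \adj M = defpoly F *: \row_i u i.
    by apply/rowP => i; rewrite def_u !mxE.
  move/(congr1 (mulmx^~ M)); rewrite -mulmxA mul_adj_mx mul_mx_scalar detM -scalemxAl.
  rewrite mulrC -scalerA => /rowP eq_Q; apply/rowP => j.
  by apply: (mulfI nzQ); have := eq_Q j; rewrite !mxE.
exists (c^-1%:MP *: \row_i u i).
by rewrite -scalemxAl -eq_t scalerA -mpolyCM mulVf // mpolyC1 scale1r.
Qed.

Lemma det_homog (d : 'I_l -> nat) (M : 'M[S]_l) :
  (forall i j, M i j \is (d i).-homog) -> \det M \is (\sum_i d i).-homog.
Proof.
move=> hM; apply: rpred_sum => s _.
rewrite mulr_sign; case: ifP => _; rewrite ?rpredN;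
  by elim/big_rec2: _ => [|i n f _ hf]; [apply: dhomog1 | apply: dhomogM].
Qed.

(** The determinant is nonzero, divisible by the defining polynomial and of the same degree, so the
    quotient is a nonzero constant. *)
Lemma homog_basis_saito F (d : 'I_l -> nat) (M : 'M[S]_l) :
    simple_forms F -> (\sum_i d i = size F)%N ->
    (forall i, logder F (row i M)) -> (forall i j, M i j \is (d i).-homog) ->
    (forall t, t *m M = 0 -> t = 0) -> saito F M.
Proof.
move=> sF sum_d FM hM indep; split=> //.
have nz_det : \det M != 0.
  by apply/det0P => -[t nz_t /indep t0]; rewrite t0 eqxx in nz_t.
have [|g def_det] := defpoly_dvd (f := \det M) sF.
  move=> a Fa; apply: (logder_det (F := F)) => //.
  by case: sF => _ /(_ a Fa).
have nz_g : g != 0 by apply: contra nz_det => /eqP g0; rewrite def_det g0 mulr0.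
have := det_homog hM; rewrite def_det sum_d => hdet.
have [_] := dhomog_divl (defpoly_homog F) (defpoly_neq0 sF) hdet nz_g.
rewrite subnn => /dhomog0_const[c def_g]; exists c; last by rewrite def_g mulrC.
by apply: contra nz_g => /eqP c0; rewrite def_g c0 mpolyC0.
Qed.

Lemma saito_perm F G M : perm_eq F G -> saito F M -> saito G M.
Proof.
move=> eqFG [FM [c nz_c detM]]; split; last first.
  by exists c; rewrite // /defpoly -(perm_big _ eqFG).
by move=> i a; rewrite -(perm_mem eqFG); apply: FM.
Qed.

(* Group the forms [b] of [P] by the hyperplane of [B] defined by [b - a]. On one
   class [der t (b - a) = h * (b - a)] with the same [h], so [der t a - h * a] is
   divisible by all the [b] of the class; restricted to [a = 0], distinct classes
   are coprime. *)
Lemma fiber_divisibility (B P : seq V) a v t :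
    simple_forms P -> a \notin P -> dot a v = 1 ->
    (forall b, b \in P -> dot b v = 1) ->
    (forall b, b \in P -> exists2 d, d \in B & exists c, b - a = c *: d) ->
    logder (B ++ P) t ->
  exists h q, der t a = linpoly a * h + defpoly P * q.
Proof.
move=> sP nPa av1 Pv1 modP Dt; pose rho := hrestr a v.
have rhoP b : b \in P -> rho (linpoly b) = linpoly (b - a).
  by move=> Pb; rewrite /rho hrestr_linpoly Pv1 // scale1r.
have nzP b : b \in P -> b - a != 0.
  by rewrite subr_eq0; apply: contraTneq => ->.
have : pdvd (\prod_(c <- [seq b - a | b <- P]) linpoly c) (rho (der t a)).
  apply: pdvd_classes => _ /mapP[b1 Pb1 ->]; first exact: nzP.
  have [d Bd [c def_b1]] := modP b1 Pb1.
  have [|h0 def_h0] := Dt d; first by rewrite mem_cat Bd.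
  have def_h : der t (b1 - a) = linpoly (b1 - a) * h0.
    by rewrite def_b1 derZ def_h0 linearZ /= -mul_mpolyC mulrA.
  have [||g def_g] := defpoly_dvd (F := [seq b <- P | (b - a <= b1 - a)%MS])
                            (f := der t a - linpoly a * h0).
  - apply: (simple_forms_sub _ _ sP); first by rewrite filter_uniq //; case: sP.
    by move=> b; rewrite mem_filter => /andP[].
  - move=> b; rewrite mem_filter => /andP[/sub_rVP[k def_k] Pb].
    have -> : der t a - linpoly a * h0 = der t b - linpoly b * h0.
      have -> : der t a = der t b - der t (b - a) by rewrite derB; ring.
      have -> : linpoly b = linpoly a + linpoly (b - a) by rewrite linearB; ring.
      by rewrite def_k derZ def_h linearZ /= -mul_mpolyC; ring.
    by apply: ldvdB; [apply: Dt; rewrite mem_cat Pb orbT | exists h0].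
  exists (rho g); have := congr1 rho def_g; rewrite /rho rmorphB !rmorphM /=.
  rewrite hrestr_linpoly av1 scale1r subrr raddf0 mul0r subr0 => ->.
  rewrite /defpoly big_filter hrestr_prod /= big_map; congr (_ * _).
  by rewrite big_seq_cond [RHS]big_seq_cond; apply: eq_bigr => b /andP[/rhoP].
case=> q def_q; rewrite big_map in def_q.
have {}def_q : rho (der t a) = rho (defpoly P) * q.
  rewrite def_q /rho /defpoly hrestr_prod /=; congr (_ * _).
  by rewrite big_seq [RHS]big_seq; apply: eq_bigr => b /rhoP.
have [h1 def_h1] := hrestr_mod a v (der t a).
have [h2 def_h2] := hrestr_mod a v (defpoly P).
exists (h1 - h2 * q), q; rewrite -/rho in def_h1 def_h2.
by rewrite mulrBr mulrA -def_h1 -def_h2 def_q; ring.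
Qed.

(** The degree e component of the identity has the same shape, so the correction term can be taken
    homogeneous. *)
Lemma fiber_divisibility_homog (P : seq V) a e f h q :
  f \is e.-homog -> f = linpoly a * h + defpoly P * q ->
  exists h' q', f = linpoly a * h' + defpoly P * q'
                /\ defpoly P * q' \is e.-homog.
Proof.
move=> hf def_f; have := pihomog_dE hf; rewrite {1}def_f pihomogD.
rewrite (pihomogM _ _ (linpoly_homog a)) (pihomogM _ _ (defpoly_homog P)) => eq_f.
exists (if (1 <= e)%N then pihomog mdeg (e - 1) h else 0).
exists (if (size P <= e)%N then pihomog mdeg (e - size P) q else 0).
split; first by rewrite -{1}eq_f; do 2!case: ifP; rewrite ?mulr0.
case: ifP => [le_Pe|_]; last by rewrite mulr0 rpred0.
by rewrite -(subnKC le_Pe); apply: dhomogM (defpoly_homog P) _; rewrite addKn pihomogP.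
Qed.

Definition addcol (j : 'I_l) (w : 'I_l -> S) (M : 'M[S]_l) : 'M[S]_l :=
  M + (\col_i w i) *m row j M.

Lemma row_addcol i j w M : row i (addcol j w M) = row i M + w i *: row j M.
Proof.
apply/rowP => k; rewrite !mxE big_ord1 !mxE; congr (_ + _ * _).
Qed.

(** The operation is multiplication by the identity with column j modified; transposed, this is a
    row replacement. *)
Lemma det_addcol j w M : \det (addcol j w M) = (1 + w j) * \det M.
Proof.
have -> : addcol j w M = (1%:M + (\col_i w i) *m delta_mx 0 j) *m M.
  by rewrite mulmxDl mul1mx -mulmxA -rowE.
rewrite det_mulmx -det_tr; congr (_ * _).
pose z : 'rV[S]_l := \row_i (w i + (i == j)%:R).
transitivity (\det (setrow j (z *m 1%:M) 1%:M)); last first.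
  by rewrite det_setrow_comb det1 mulr1 !mxE eqxx addrC.
congr (\det _); apply/matrixP => i k; rewrite mulmx1 !mxE big_ord1 !mxE eqxx /=.
rewrite [k == i]eq_sym; have [->|ne_ij] := eqVneq i j.
  by rewrite mulr1 addrC [j == k]eq_sym.
by rewrite mulr0n mulr0 addr0.
Qed.

(** * Levels with respect to a flag of vectors *)

Section Flag.
Variable v : 'I_l -> V.

(** In the application the v_k with k >= j span X_j, so this says that the hyperplane of a contains
    X_j. *)
Definition below (j : nat) a := [forall k : 'I_l, (j <= k)%N ==> (dot a (v k) == 0)].

Lemma belowP j a :
  reflect (forall k : 'I_l, (j <= k)%N -> dot a (v k) = 0) (below j a).
Proof.
apply: (iffP forallP) => [h k jk|h k]; first by apply/eqP/(implyP (h k)).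
by apply/implyP => jk; rewrite h.
Qed.

Definition low (F : seq V) j := [seq a <- F | below j a].
Definition level (F : seq V) j := [seq a <- F | below j.+1 a && ~~ below j a].

Lemma below_le i j a : (i <= j)%N -> below i a -> below j a.
Proof. by move=> le_ij /belowP h; apply/belowP => k /(leq_trans le_ij)/h. Qed.

Lemma low_succ F j : perm_eq (low F j.+1) (low F j ++ level F j).
Proof.
rewrite -(perm_filterC (below j) (low F j.+1)) perm_cat //.
  rewrite /low -filter_predI; apply/seq.permP => x; congr (count _ _).
  apply: eq_filter => a /=; case: (boolP (below j a)) => //= /(below_le (leqnSn j)) ->.
  by [].
rewrite /level /low -filter_predI; apply/seq.permP => x; congr (count _ _).
by apply: eq_filter => a /=; rewrite andbC.
Qed.

Lemma low_top F : low F l = F.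
Proof.
apply/all_filterP/allP => a _; apply/belowP => k.
by rewrite leqNgt ltn_ord.
Qed.

Hypothesis free_v : \det (\matrix_i v i) != 0.

Lemma below0 a : below 0 a -> a = 0.
Proof.
move/belowP => av0; have : (\matrix_i v i) *m a^T = 0.
  apply/colP => i; rewrite [RHS]mxE; transitivity (dot a (v i)); last exact: av0.
  by rewrite dotC dotE mxE; apply: eq_bigr => j _; rewrite !mxE.
move/(congr1 (mulmx (\adj (\matrix_i v i)))).
rewrite mulmxA mul_adj_mx mulmx0 mul_scalar_mx => /eqP.
by rewrite scalemx_eq0 (negbTE free_v) -trmx0 => /eqP/trmx_inj.
Qed.

End Flag.

(** * Modular flags give bases of logarithmic derivations *)

Definition adapted (v : 'I_l -> V) F :=
  [/\ simple_forms F, \det (\matrix_i v i) != 0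
    & forall a (j : 'I_l), a \in level v F j -> dot a (v j) = 1].

(** Adapted forms a, b of level j take the value 1 at v_j, so [b - a] is, up to scalars, their only
    combination vanishing there. A lower form that vanishes on the intersection of their hyperplanes
    must be proportional to it. *)
Definition modular (v : 'I_l -> V) F :=
  forall (j : 'I_l) a b, a \in level v F j -> b \in level v F j -> b != a ->
    exists2 d, d \in low v F j & exists c, b - a = c *: d.

Lemma level_dot (v : 'I_l -> V) F (j k : 'I_l) a :
  a \in level v F j -> (j < k)%N -> dot a (v k) = 0.
Proof. by rewrite mem_filter => /andP[/andP[/belowP h _] _]; apply: h. Qed.

Lemma low_dot (v : 'I_l -> V) F j (k : 'I_l) a :
  a \in low v F j -> (j <= k)%N -> dot a (v k) = 0.
Proof. by rewrite mem_filter => /andP[/belowP h _]; apply: h. Qed.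

Lemma low_level_simple (v : 'I_l -> V) F (j : nat) P : simple_forms F ->
  uniq P -> {subset P <= level v F j} -> simple_forms (low v F j ++ P).
Proof.
move=> sF uP sP; apply: (simple_forms_sub _ _ sF); last first.
  move=> a; rewrite mem_cat => /orP[|/sP]; rewrite mem_filter => /andP[] //.
rewrite cat_uniq uP andbT filter_uniq; last by case: sF.
apply/hasPn => a /sP; rewrite !mem_filter => /andP[/andP[_ /negbTE ->]] //.
Qed.

(** One more form a of level j is added: rows i < j become logarithmic for a after adding a multiple
    of row j, row j is multiplied by a, and the constant rows i > j already annihilate a. *)
Lemma add_form (v : 'I_l -> V) F (n : 'I_l -> nat) (j : 'I_l) P a M :
    adapted v F -> modular v F -> uniq (a :: P) ->
    {subset a :: P <= level v F j} ->
    saito (low v F j ++ P) M ->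
    (forall i k : 'I_l, (i < j)%N -> M i k \is (n i).-homog) ->
    row j M = defpoly P *: cst (v j) ->
    (forall i : 'I_l, (j < i)%N -> row i M = cst (v i)) ->
  exists M' : 'M[S]_l,
    [/\ saito (low v F j ++ a :: P) M',
        forall i k : 'I_l, (i < j)%N -> M' i k \is (n i).-homog,
        row j M' = defpoly (a :: P) *: cst (v j)
      & forall i : 'I_l, (j < i)%N -> row i M' = cst (v i)].
Proof.
move=> [sF _ nF] modF /= /andP[nPa uP] sP [logM [c nz_c detM]] homM rowj rowM.
have sPF b : b \in P -> b \in level v F j by move=> Pb; apply: sP; rewrite inE Pb orbT.
have Fa : a \in level v F j by apply: sP; apply: mem_head.
have der_j b : der (row j M) b = defpoly P * (dot b (v j))%:MP.
  by rewrite rowj derZl der_cst.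
have /fin_all_exists[q def_q] : forall i : 'I_l, exists q : S, (i < j)%N ->
    (exists h, der (row i M) a = linpoly a * h + defpoly P * q)
    /\ defpoly P * q \is (n i).-homog.
  move=> i; case: (ltnP i j) => [lt_ij|_]; last by exists 0.
  have [|||||h [q def_a]] := fiber_divisibility (B := low v F j) (v := v j)
                              (a := a) (P := P) _ _ _ _ _ (logM i).
  - have := low_level_simple sF uP sPF; apply: simple_forms_sub => //.
    by move=> b Pb; rewrite mem_cat Pb orbT.
  - by [].
  - exact: nF.
  - by move=> b /sPF; apply: nF.
  - move=> b Pb; apply: (modF j) => //; first exact: sPF.
    by apply: contraNneq nPa => <-.
  have hom_a : der (row i M) a \is (n i).-homog.
    by apply: der_homog => k; rewrite mxE; apply: homM.
  have [h' [q' [def' hom']]] := fiber_divisibility_homog hom_a def_a.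
  by exists q' => _; split=> //; exists h'.
(* At i = j the value [linpoly a - 1] makes both row j and the determinant get multiplied by
   [linpoly a]. *)
pose w (i : 'I_l) := if (i < j)%N then - q i else if i == j then linpoly a - 1 else 0.
exists (addcol j w M); split.
- split; last first.
    exists c => //; rewrite det_addcol detM /w ltnn eqxx !defpoly_cat.
    by rewrite [defpoly (a :: P)]big_cons -/(defpoly P); ring.
  move=> i b; rewrite mem_cat inE orbCA -mem_cat row_addcol derDl derZl.
  case/predU1P => [->|Gb]; last by apply: ldvdD; [|apply: ldvdMl]; apply: logM.
  rewrite der_j (nF _ _ Fa) mpolyC1 mulr1 /w.
  case: (ltngtP i j) => [lt_ij|lt_ji|eq_ij].
  + have [[h ->] _] := def_q i lt_ij; exists h; ring.
  + rewrite rowM // der_cst (level_dot Fa) // mpolyC0 add0r.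
    by rewrite -(inj_eq val_inj) gtn_eqF // mul0r; apply: ldvd0.
  + rewrite (val_inj eq_ij) eqxx der_j (nF _ _ Fa) mpolyC1.
    by exists (defpoly P); ring.
- move=> i k lt_ij; have := row_addcol i j w M => /rowP/(_ k).
  rewrite [LHS]mxE => ->; rewrite rowj /w lt_ij !mxE.
  have [_ hom_q] := def_q i lt_ij.
  apply: rpredD; first exact: homM.
  have -> : - q i * (defpoly P * (v j 0 k)%:MP) = - (v j 0 k) *: (defpoly P * q i).
    by rewrite -mul_mpolyC mpolyCN; ring.
  exact: dhomogZ.
- rewrite row_addcol /w ltnn eqxx rowj -{1}[defpoly P *: _]scale1r -scalerDl.
  by rewrite addrC subrK scalerA [defpoly (a :: P)]big_cons.
- move=> i lt_ji; rewrite row_addcol rowM // /w ltnNge (ltnW lt_ji) /=.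
  by rewrite -(inj_eq val_inj) gtn_eqF // scale0r addr0.
Qed.

Theorem modular_saito (v : 'I_l -> V) F : adapted v F -> modular v F ->
  exists2 M : 'M[S]_l, saito F M
    & forall i k, M i k \is (size (level v F i)).-homog.
Proof.
move=> adF modF; have [sF free_v nF] := adF.
pose n (i : 'I_l) := size (level v F i).
have IH j : (j <= l)%N -> exists M : 'M[S]_l, [/\ saito (low v F j) M,
    forall i k : 'I_l, (i < j)%N -> M i k \is (n i).-homog
    & forall i : 'I_l, (j <= i)%N -> row i M = cst (v i)]; last first.
  have [//|M [sM hM _]] := IH l _.
  by exists M; [rewrite low_top in sM | move=> i k; apply: hM].
elim: j => [_|j IHj lt_jl].
  (* The constant fields v_i are a basis for the empty arrangement; nothing lies below index 0, as
     no nonzero form vanishes at every v_i. *)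
  exists (\matrix_i cst (v i)); split=> // [|i _]; last exact: rowK.
  have -> : low v F 0 = [::].
    apply/eqP; rewrite -[_ == _]negbK -has_filter; apply/hasPn => a Fa.
    by apply/negP => /(below0 free_v) a0; case: sF => _ /(_ a Fa); rewrite a0 eqxx.
  split=> //; exists (\det (\matrix_i v i)) => //.
  rewrite /defpoly big_nil mulr1 -det_map_mx; congr (\det _).
  by apply/matrixP => i k; rewrite !mxE.
have [M [sM hM rM]] := IHj (ltnW lt_jl).
pose o := Ordinal lt_jl.
suff [M' [sM' hM' rj rM']] : exists M' : 'M[S]_l,
    [/\ saito (low v F o ++ level v F o) M',
        forall i k : 'I_l, (i < o)%N -> M' i k \is (n i).-homog,
        row o M' = defpoly (level v F o) *: cst (v o)
      & forall i : 'I_l, (o < i)%N -> row i M' = cst (v i)].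
  exists M'; split=> //.
  - by apply: saito_perm sM'; rewrite perm_sym; apply: low_succ.
  - move=> i k; rewrite ltnS leq_eqVlt => /predU1P[eq_ij|]; last exact: hM'.
    have -> : i = o by apply: val_inj.
    have := congr1 (fun u : 'rV[S]_l => u 0 k) rj; rewrite !mxE => ->.
    rewrite -[(n o)]addn0; apply: dhomogM; first exact: defpoly_homog.
    exact: dhomog_const.
have : uniq (level v F o) by apply: filter_uniq; case: sF.
have : {subset level v F o <= level v F o} by [].
(* The occurrence that bounds the list stays fixed, so the forms of the level are added one at a
   time. *)
elim: {-2}(level v F o) => [_ _|a P IHP sP uP].
  exists M; rewrite cats0; split=> // [|i lt_oi]; last by apply: rM; apply: ltnW.
  by rewrite /defpoly big_nil scale1r rM.
have [||M' [sM' hM' rj rM']] := IHP.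
- by move=> b Pb; apply: sP; rewrite inE Pb orbT.
- by case/andP: uP.
exact: (add_form adF modF uP sP sM' hM' rj rM').
Qed.

(** * Peeling levels off a free arrangement *)

Definition level_size (v : 'I_l -> V) F (i : 'I_l) := size (level v F i).

Lemma mem_low_succ (v : 'I_l -> V) F j a :
  (a \in low v F j.+1) = (a \in low v F j) || (a \in level v F j).
Proof. by rewrite (perm_mem (low_succ v F j)) mem_cat. Qed.

Lemma logder_level (v : 'I_l -> V) F (j : 'I_l) :
  logder (low v F j.+1) (defpoly (level v F j) *: cst (v j)).
Proof.
move=> a; rewrite mem_low_succ derZl der_cst => /orP[Fa|Fa].
  by rewrite (low_dot Fa) // mpolyC0 mulr0; apply: ldvd0.
by apply: ldvdMr; apply: ldvd_defpoly.
Qed.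

Lemma low_simple (v : 'I_l -> V) F j : simple_forms F -> simple_forms (low v F j).
Proof.
move=> sF; apply: (simple_forms_sub _ _ sF); first by rewrite filter_uniq; case: sF.
by move=> a; rewrite mem_filter => /andP[].
Qed.

Definition flag_saito (v : 'I_l -> V) F (n : 'I_l -> nat) (j : nat) M :=
  [/\ saito (low v F j) M,
      forall i k : 'I_l, (i < j)%N -> M i k \is (n i).-homog
    & forall i : 'I_l, (j <= i)%N -> row i M = cst (v i)].

Section Peel.
Variables (v : 'I_l -> V) (F : seq V).
Local Notation n := (level_size v F).
Hypothesis adF : adapted v F.
Hypothesis n_first : forall i : 'I_l, val i = 0%N -> n i = 1%N.
Hypothesis n_pos : forall i : 'I_l, (0 < n i)%N.
Hypothesis n_decr : forall i j : 'I_l, (0 < i <= j)%N -> (n j <= n i)%N.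

(** Replacing row i of M by the combination multiplies the determinant by [u 0 i] and changes the
    degree of that row from n_i to n_j. Both determinants are homogeneous, hence so is their
    ratio. *)
Lemma comb_degree (j : 'I_l) M (u : 'rV[S]_l) (i : 'I_l) :
    flag_saito v F n j.+1 M -> u *m M = defpoly (level v F j) *: cst (v j) ->
    (i <= j)%N -> u 0 i != 0 ->
  (n i <= n j)%N /\ u 0 i \is (n j - n i).-homog.
Proof.
case: adF => sF _ _ [sM hM rM] def_u le_ij nz_ui.
pose d (k : 'I_l) := if (k <= j)%N then n k else 0%N.
have hd k k' : M k k' \is (d k).-homog.
  rewrite /d; case: leqP => [|lt_jk]; first exact: hM.
  by have /rowP/(_ k') := rM k lt_jk; rewrite !mxE => ->; apply: dhomog_const.
have := det_homog hd; rewrite (bigD1 i) //= {1}/d le_ij => hdet.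
pose d' k := if k == i then n j else d k.
have hd' k k' : setrow i (u *m M) M k k' \is (d' k).-homog.
  rewrite mxE /d'; case: ifP => // _; rewrite def_u !mxE -[n j]addn0.
  by apply: dhomogM; [apply: defpoly_homog | apply: dhomog_const].
have := det_homog hd'; rewrite (bigD1 i) //= {1}/d' eqxx.
rewrite (eq_bigr d) => [|k /negbTE]; last by rewrite /d' => ->.
rewrite det_setrow_comb mulrC => hdet'.
have := dhomog_divl hdet (saito_det_neq0 (low_simple _ _ sF) sM) hdet' nz_ui.
by rewrite leq_add2r subnDr.
Qed.

(** A nonzero coordinate with 0 < i <= j has n_i <= n_j by degrees and n_j <= n_i by monotonicity,
    so it is constant. Index 0 lies outside the monotonicity and is treated separately. *)
Lemma comb_unit (j : 'I_l) M (u : 'rV[S]_l) :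
    flag_saito v F n j.+1 M -> u *m M = defpoly (level v F j) *: cst (v j) ->
  exists i : 'I_l, [/\ (i <= j)%N, n i = n j & exists2 c, c != 0 & u 0 i = c%:MP].
Proof.
move=> sMj def_u; have [sF _ nF] := adF; have [sM hM rM] := sMj.
pose R := defpoly (level v F j).
have sL : simple_forms (level v F j).
  apply: (simple_forms_sub _ _ sF); first by rewrite filter_uniq; case: sF.
  by move=> a; rewrite mem_filter => /andP[].
have nzR : R != 0 by apply: defpoly_neq0.
have unit_i (i : 'I_l) : (i <= j)%N -> u 0 i != 0 -> n j = n i ->
    exists2 c, c != 0 & u 0 i = c%:MP.
  move=> le_ij nz_ui eq_n; have [_] := comb_degree sMj def_u le_ij nz_ui.
  rewrite eq_n subnn => /dhomog0_const[c def_c]; exists c => //.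
  by apply: contra nz_ui => /eqP c0; rewrite def_c c0 mpolyC0.
case: (pickP (fun i : 'I_l => [&& (0 < i)%N, (i <= j)%N & u 0 i != 0])) => [i|no_i].
  case/and3P=> i_gt0 le_ij nz_ui.
  have [le_n _] := comb_degree sMj def_u le_ij nz_ui.
  have eq_n : n j = n i by apply/eqP; rewrite eqn_leq le_n n_decr // i_gt0.
  by exists i; split=> //; apply: unit_i.
(* Only row 0 remains: were [n j >= 2], two forms of level [j] would divide the
   linear polynomial [der (row 0 M) a]. *)
have l_gt0 : (0 < l)%N by apply: leq_ltn_trans (ltn_ord j).
pose o := Ordinal l_gt0.
(* Apply the combination to a: rows i > j annihilate a, and rows 0 < i <= j have coefficient
   zero. *)
have eqR a : a \in level v F j -> R = u 0 o * der (row o M) a.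
  move=> La; have := congr1 (fun t => der t a) def_u.
  rewrite derZl der_cst (nF _ _ La) mpolyC1 mulr1 -/R => <-.
  rewrite der_mul (bigD1 o) //= big1 ?addr0 // => i ne_i0.
  have i_gt0 : (0 < i)%N by rewrite lt0n; apply: contra ne_i0 => /eqP i0; apply/eqP/val_inj.
  have [le_ij|lt_ji] := leqP i j; last first.
    by rewrite rM // der_cst (level_dot La) // mpolyC0 mulr0.
  by have := no_i i; rewrite i_gt0 le_ij /= => /negbFE/eqP ->; rewrite mul0r.
have [a La] : exists a, a \in level v F j.
  have := n_pos j; rewrite /level_size; case: (level v F j) => // a L _.
  by exists a; apply: mem_head.
have nz_u0 : u 0 o != 0.
  by apply: contra nzR => /eqP u0; rewrite (eqR a La) u0 mul0r.
have [n1|n_gt1] := leqP (n j) 1.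
  have eq_n : n j = n o.
    by rewrite (n_first (i := o)) //; apply/eqP; rewrite eqn_leq n1 n_pos.
  by exists o; split=> //; apply: unit_i.
have [b Lb neq_ba] : exists2 b, b \in level v F j & b != a.
  have [uL _ _] := sL; have := perm_to_rem La => /perm_size /=.
  case def_r: (rem a _) => [|b L] eq_sz; first by move: n_gt1; rewrite /level_size eq_sz.
  have: b \in rem a (level v F j) by rewrite def_r mem_head.
  by rewrite mem_rem_uniq // inE => /andP[nba Lb]; exists b.
have eq_ab : der (row o M) a = der (row o M) b.
  by apply: (mulfI nz_u0); rewrite -!eqR.
have logM0 : logder (level v F j) (row o M).
  by apply: logder_sub (proj1 sM o) => c Lc; rewrite mem_low_succ Lc orbT.
have [||g def_g] := defpoly_dvd (F := [:: a; b]) (f := der (row o M) a).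
- apply: simple_forms_sub sL => /=; first by rewrite inE eq_sym neq_ba.
  by move=> c; rewrite !inE => /orP[] /eqP ->.
- move=> c; rewrite !inE => /orP[] /eqP ->; last rewrite eq_ab; exact: logM0.
have nz_der : der (row o M) a != 0.
  by apply: contra nzR => /eqP d0; rewrite (eqR a La) d0 mulr0.
have hom1 : der (row o M) a \is 1.-homog.
  apply: der_homog => k; rewrite mxE -(n_first (i := o)) //.
  exact: hM.
rewrite def_g in hom1 nz_der.
have [||] // := dhomog_divl (defpoly_homog [:: a; b]) _ hom1 _.
  by apply: contra nz_der => /eqP ->; rewrite mul0r.
by apply: contra nz_der => /eqP ->; rewrite mulr0.
Qed.

(** The new row replaces a row i where its coordinate is a nonzero constant, which alters the
    determinant only by a constant. Swapping rows i and j then respects the degrees because n_i =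
    n_j. *)
Lemma exchange_row (j : 'I_l) M : flag_saito v F n j.+1 M ->
  exists M' : 'M[S]_l,
    flag_saito v F n j.+1 M' /\ row j M' = defpoly (level v F j) *: cst (v j).
Proof.
move=> sMj; have [sM hM rM] := sMj; have [sF _ _] := adF.
pose t := defpoly (level v F j) *: cst (v j).
have [u def_t] := saito_span (low_simple v j.+1 sF) sM (logder_level (v := v) (F := F) (j := j)).
have [i [le_ij eq_n [c nz_c def_ui]]] := comb_unit sMj (esym def_t).
have [logM [e nz_e detM]] := sM.
pose N := setrow i t M; pose M' := xrow i j N.
have rowM' k : row k M' = row (tperm i j k) N.
  by apply/rowP => k'; rewrite !mxE.
have row_j : row j M' = t by rewrite rowM' tpermR row_setrow eqxx.
exists M'; split=> //; split; first split.
- by move=> k; rewrite rowM' row_setrow; case: ifP => _ //; apply: logder_level.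
- exists ((if odd_perm (tperm i j) then -1 else 1) * c * e).
    by rewrite !mulf_neq0 //; case: ifP; rewrite ?oppr_eq0 oner_eq0.
  rewrite /M' xrowE det_mulmx det_perm /N /t def_t det_setrow_comb def_ui detM.
  by rewrite mulr_sign; case: ifP => _; rewrite !mpolyCM ?mpolyCN mpolyC1; ring.
- move=> k k' le_kj; have /rowP/(_ k') := rowM' k; rewrite [LHS]mxE => ->.
  have [->|ne_kj] := eqVneq k j.
    rewrite tpermR row_setrow eqxx !mxE -[X in X.-homog]addn0.
    by apply: dhomogM; [apply: defpoly_homog | apply: dhomog_const].
  have [eq_ki|ne_ki] := eqVneq k i.
    rewrite eq_ki tpermL row_setrow; case: ifP => [/eqP eq_ji|_].
      by rewrite eq_ki eq_ji eqxx in ne_kj.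
    by rewrite mxE eq_n; apply: hM.
  rewrite tpermD 1?eq_sym // row_setrow (negbTE ne_ki) mxE.
  exact: hM.
- move=> k lt_jk; have lt_ik := leq_ltn_trans le_ij lt_jk.
  rewrite rowM' tpermD -?(inj_eq val_inj) ?ltn_eqF // row_setrow.
  by rewrite -(inj_eq val_inj) gtn_eqF // rM.
Qed.

(** Once row j is R v_j, with R the product of level j, replacing it by v_j divides the determinant
    by R, as the criterion for the lower levels asks. The rows before j stay logarithmic for level
    j, which [saito_level_modular] exploits. *)
Lemma peel_level (j : 'I_l) M : flag_saito v F n j.+1 M ->
  exists M' : 'M[S]_l, flag_saito v F n j M'
    /\ forall i : 'I_l, (i < j)%N -> logder (low v F j.+1) (row i M').
Proof.
case/exchange_row => M1 [[[logM [c nz_c detM]] hM rM] rj].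
have [sF _ _] := adF.
have rowM' i : row i (setrow j (cst (v j)) M1) = if i == j then cst (v j) else row i M1.
  exact: row_setrow.
exists (setrow j (cst (v j)) M1); split; last first.
  by move=> i lt_ij; rewrite rowM' -(inj_eq val_inj) ltn_eqF.
split; first split.
- move=> i; rewrite rowM'; case: ifP => _.
    by move=> a Fa; rewrite der_cst (low_dot Fa) // mpolyC0; apply: ldvd0.
  by apply: logder_sub (logM i) => a Fa; rewrite mem_low_succ Fa.
- exists c => //; have nzR : defpoly (level v F j) != 0.
    apply: defpoly_neq0; apply: (simple_forms_sub _ _ sF).
      by rewrite filter_uniq; case: sF.
    by move=> a; rewrite mem_filter => /andP[].
  apply: (mulfI nzR); rewrite -det_setrowZ -rj.
  have -> : setrow j (row j M1) M1 = M1.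
    by apply/row_matrixP => i; rewrite row_setrow; case: eqP => [->|].
  rewrite detM {1}/defpoly (perm_big _ (low_succ v F j)) big_cat /=.
  by rewrite -!/(defpoly _); ring.
- move=> i k lt_ij; rewrite mxE -(inj_eq val_inj) ltn_eqF //.
  by apply: hM; apply: leqW.
- move=> i; rewrite leq_eqVlt rowM' => /predU1P[/val_inj ->|lt_ji]; first by rewrite eqxx.
  by rewrite -(inj_eq val_inj) gtn_eqF // rM.
Qed.

(** Expand Q w in the basis, apply it to b - a and restrict to a = 0 along v_j. Rows i < j give a
    multiple of b minus a multiple of a, which restricts to a multiple of b - a; the other rows
    annihilate b - a. Lower forms vanish at v_j, so Q restricts to itself, and b - a divides one of
    its factors. *)
Lemma saito_level_modular (j : 'I_l) M a b : flag_saito v F n j M ->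
    (forall i : 'I_l, (i < j)%N -> logder (low v F j.+1) (row i M)) ->
    a \in level v F j -> b \in level v F j -> b != a ->
  exists2 d, d \in low v F j & exists c, b - a = c *: d.
Proof.
case=> sM _ rM logM La Lb neq_ba; have [sF _ nF] := adF.
have nz_g : b - a != 0 by rewrite subr_eq0.
(* With this normalization Q w applied to b - a is exactly Q. *)
have [w gw1] := dot_dual nz_g.
have DQ : logder (low v F j) (defpoly (low v F j) *: cst w).
  exact: logder_defpoly.
have [u def_u] := saito_span (low_simple v j sF) sM DQ.
have lowS c : c \in level v F j -> c \in low v F j.+1.
  by rewrite mem_low_succ orbC => ->.
pose rho := hrestr a (v j).
have dvd_rho : ldvd (b - a) (rho (defpoly (low v F j))).
  have -> : defpoly (low v F j) = der (u *m M) (b - a).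
    by rewrite -def_u derZl der_cst gw1 mpolyC1 mulr1.
  rewrite der_mul /rho rmorph_sum /=; apply: ldvd_sum => i _ _.
  rewrite rmorphM; apply: ldvdMl; have [lt_ij|le_ji] := ltnP i j.
    have [f def_f] := logM i lt_ij b (lowS b Lb).
    have [g def_g] := logM i lt_ij a (lowS a La).
    exists (hrestr a (v j) f); rewrite derB def_f def_g rmorphB !rmorphM /= !hrestr_linpoly.
    by rewrite (nF _ _ La) (nF _ _ Lb) !scale1r subrr raddf0 mul0r subr0.
  suff -> : der (row i M) (b - a) = 0 by rewrite rmorph0; apply: ldvd0.
  rewrite rM // der_cst dotBl; move: le_ji; rewrite leq_eqVlt.
  case/predU1P => [/val_inj <-|lt_ji]; first by rewrite !nF // subrr mpolyC0.
  by rewrite (level_dot La lt_ji) (level_dot Lb lt_ji) subrr mpolyC0.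
have rhoQ : rho (defpoly (low v F j)) = defpoly (low v F j).
  rewrite /rho /defpoly hrestr_prod big_seq [RHS]big_seq; apply: eq_bigr => d Fd.
  by rewrite hrestr_linpoly (low_dot Fd) // scale0r subr0.
rewrite rhoQ in dvd_rho.
have [d Fd /(ldvd_linpoly nz_g)[c def_d]] := ldvd_prime_prod nz_g dvd_rho.
exists d => //; exists c^-1; rewrite def_d scalerA mulVf ?scale1r //.
have [_ nzF _] := low_simple v j sF.
by apply: contraNneq (nzF d Fd) => c0; rewrite def_d c0 scale0r.
Qed.

Theorem saito_modular M : saito F M ->
  (forall i k, M i k \is (n i).-homog) -> modular v F.
Proof.
move=> sM hM; suff flagM j : (j <= l)%N -> exists M' : 'M[S]_l, flag_saito v F n j M'.
  move=> j a b La Lb neq_ba.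
  have [M1 /peel_level[M2 [sM2 logM2]]] := flagM j.+1 (ltn_ord j).
  exact: saito_level_modular sM2 logM2 La Lb neq_ba.
(* Downward induction from j = l, run on the difference l - j. *)
move=> le_jl; rewrite -(subKn le_jl).
elim: (l - j)%N (leq_subr j l) => [_|m IHm lt_ml].
  exists M; rewrite subn0; split; rewrite ?low_top // => i.
  by rewrite leqNgt ltn_ord.
have [M1] := IHm (ltnW lt_ml); have lt_jl' : (l - m.+1 < l)%N.
  by rewrite ltn_subrL (leq_trans _ lt_ml).
rewrite -[(l - m)%N](subnSK lt_ml) => /(peel_level (j := Ordinal lt_jl'))[M2 [sM2 _]].
by exists M2.
Qed.

End Peel.

(** * Hyperplanes as kernels of linear forms *)

Implicit Types (A : seq {vspace V}) (H U W Y Z : {vspace V}).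

Lemma dim_rV : \dim {:V} = l.
Proof. by rewrite dimvf dim_matrix mul1r. Qed.

Lemma mem_kerform a x : (x \in kerform a) = (dot x a == 0).
Proof.
rewrite memv_ker lfunE /= /dot; apply/eqP/eqP => [-> | x0]; first by rewrite mxE.
by apply/matrixP => i j; rewrite !ord1 [RHS]mxE.
Qed.

Lemma kerform_hyperplane a : a != 0 -> is_hyperplane (kerform a).
Proof.
move=> nz_a; set f := linfun (mulmxr a^T : V -> 'M[K]_(1, 1)).
have := limg_ker_dim f fullv; rewrite capfv -/(kerform a) dim_rV => def_l.
have le1 : (\dim (limg f) <= 1)%N.
  by apply: leq_trans (dimvS (subvf _)) _; rewrite dimvf dim_matrix.
have [w aw1] := dot_dual nz_a.
have gt0 : (0 < \dim (limg f))%N.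
  rewrite lt0n dimv_eq0; apply/eqP => img0.
  have: f w \in limg f by rewrite memv_img ?memvf.
  rewrite img0 memv0 lfunE /= => /eqP/matrixP/(_ 0 0).
  by rewrite -[LHS]/(dot w a) dotC aw1 mxE => /eqP; rewrite oner_eq0.
have e1 : \dim (limg f) = 1%N by apply/eqP; rewrite eqn_leq le1.
by move: def_l; rewrite e1 addn1 => /eqP.
Qed.

(** A basis of H has fewer than l vectors, so a nonzero form vanishes on it; its kernel contains H
    and has the same dimension. *)
Lemma hyperplane_form H : is_hyperplane H -> exists2 a, a != 0 & kerform a = H.
Proof.
move=> hypH; pose B := \matrix_(i < \dim H) (vbasis H)`_i.
have : kermx B^T != 0.
  rewrite kermx_eq0 /row_free neq_ltn (leq_ltn_trans (rank_leq_col _)) //.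
  exact: eq_leq (eqP hypH).
case/rowV0Pn => a /sub_kermxP aB0 nz_a; exists a => //.
apply/esym/eqP; rewrite eqEdim; apply/andP; split; last first.
  by rewrite -ltnS (eqP hypH) (eqP (kerform_hyperplane nz_a)).
rewrite -{1}(span_basis (vbasisP H)); apply/span_subvP => x /(nthP 0)[i].
rewrite size_tuple => lt_i <-; rewrite mem_kerform dotC /dot.
have := congr1 (fun r : 'rV_(\dim H) => r 0 (Ordinal lt_i)) aB0; rewrite [RHS]mxE => <-.
rewrite !mxE; apply/eqP; apply: eq_bigr => j _.
by rewrite !mxE.
Qed.

(** With a(w) = 1, the vectors e_i - a_i w lie in the kernel of a; testing b on them gives b_i =
    b(w) a_i. *)
Lemma kerform_sub a b : a != 0 -> (kerform a <= kerform b)%VS -> exists c, b = c *: a.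
Proof.
case/dot_dual=> w aw1 /subvP sab; exists (dot b w); apply/rowP => i.
have := sab (delta_mx 0 i - a 0 i *: w); rewrite !mem_kerform !dotBl !dotZl.
have dot_delta c : dot (delta_mx 0 i) c = c 0 i.
  rewrite dotE (bigD1 i) //= big1 ?addr0; first by rewrite !mxE !eqxx mul1r.
  by move=> j ne_ji; rewrite !mxE (negbTE ne_ji) andbF mul0r.
rewrite !dot_delta dotC aw1 mulr1 subrr eqxx => /(_ isT).
by rewrite subr_eq0 mxE [dot w b]dotC mulrC => /eqP.
Qed.

Lemma kerformZ c a : c != 0 -> kerform (c *: a) = kerform a.
Proof.
move=> nz_c; apply/vspaceP => x.
by rewrite !mem_kerform dotC dotZl mulf_eq0 (negbTE nz_c) /= dotC.
Qed.

Lemma hyperplane_eq H1 H2 :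
  is_hyperplane H1 -> is_hyperplane H2 -> (H1 <= H2)%VS -> H1 = H2.
Proof.
move=> h1 h2 s12; apply/eqP; rewrite eqEdim s12 /=.
by rewrite -ltnS (eqP h1) (eqP h2).
Qed.

Lemma dim_cap_hyperplane U H :
  is_hyperplane H -> ~~ (U <= H)%VS -> (\dim (U :&: H)).+1 = \dim U.
Proof.
move=> hH nUH; have := dimv_sum_cap U H.
have dimH := eqP hH; have -> : \dim (U + H) = l.
  have := dimvS (subvf (U + H)%VS); rewrite dim_rV => le_l.
  apply/eqP; rewrite eqn_leq le_l (leq_trans (eq_leq (esym dimH))) // ltnNge.
  apply: contra nUH => le_dim; have /eqP -> : H == (U + H)%VS.
    by rewrite eqEdim addvSr.
  exact: addvSl.
move=> eq_dim; apply/eqP; rewrite -(eqn_add2r (\dim H)) -eq_dim addSnnS dimH.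
by rewrite addnC.
Qed.

Lemma hyperplane_cap_eq U W H : is_hyperplane H -> ~~ (U <= H)%VS ->
  (W <= U)%VS -> (W <= H)%VS -> (\dim W).+1 = \dim U -> W = (U :&: H)%VS.
Proof.
move=> hH nUH sWU sWH dimW; apply/eqP; rewrite eqEdim subv_cap sWU sWH /=.
by rewrite -ltnS dimW dim_cap_hyperplane.
Qed.

Lemma Lk_dim k A Y : Y \in Lk k A -> \dim Y = (l - k)%N.
Proof.
rewrite mem_undup => /mapP[J]; rewrite mem_filter => /andP[/eqP dimJ _] ->.
exact: dimJ.
Qed.

Lemma Lk_sub k A Y U : Y \in Lk k A ->
  (forall H, H \in A -> (Y <= H)%VS -> (U <= H)%VS) -> (U <= Y)%VS.
Proof.
rewrite mem_undup => /mapP[J _ ->] sUH; apply/subv_bigcapP => i Ji.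
by apply: sUH; [apply: mem_nth | apply: (@bigcapv_inf _ _ _ i)].
Qed.

Lemma cap_Lk2 A H1 H2 : is_arrangement A -> H1 \in A -> H2 \in A -> H1 != H2 ->
  (H1 :&: H2)%VS \in Lk 2 A.
Proof.
case/andP=> uA /allP hypA A1 A2 neq12.
have lt1 : (index H1 A < size A)%N by rewrite index_mem.
have lt2 : (index H2 A < size A)%N by rewrite index_mem.
pose J := [set Ordinal lt1; Ordinal lt2].
have def_J : capA J = (H1 :&: H2)%VS.
  apply/eqP; rewrite eqEsubv subv_cap -andbA; apply/and3P; split.
  - by apply: (@bigcapv_inf _ _ _ (Ordinal lt1)); rewrite ?inE ?eqxx //= nth_index.
  - by apply: (@bigcapv_inf _ _ _ (Ordinal lt2)); rewrite ?inE ?eqxx ?orbT //= nth_index.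
  - apply/subv_bigcapP => i; rewrite !inE => /orP[] /eqP -> /=; rewrite nth_index //.
      exact: capvSl.
    exact: capvSr.
rewrite mem_undup -def_J; apply/mapP; exists J => //.
rewrite mem_filter mem_enum andbT def_J.
have n12 : ~~ (H1 <= H2)%VS.
  by apply: contra neq12 => s12; apply/eqP/hyperplane_eq => //; apply: hypA.
have := dim_cap_hyperplane (hypA _ A2) n12; have := eqP (hypA _ A1).
by move=> dim1; rewrite -(congr1 (subn^~ 2) dim1) subn2 /= => <-.
Qed.

(** * Multiplicities of iterated restrictions *)

Section Restrictions.
Variables (A : seq {vspace V}) (X : nat -> {vspace V}).
Hypothesis arrA : is_arrangement A.
Hypothesis flagX : is_flag A X.

Lemma arr_hyperplane H : H \in A -> is_hyperplane H.
Proof. by case/andP: arrA => _ /allP h /h. Qed.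

Lemma flag_dim i : (i <= l)%N -> \dim (X i) = (l - i)%N.
Proof. by case: flagX => _ _ h _ /h/Lk_dim. Qed.

Lemma flag_dimS i : (i < l)%N -> (\dim (X i.+1)).+1 = \dim (X i).
Proof. by move=> lt_il; rewrite !flag_dim ?(ltnW lt_il) // subnSK. Qed.

Lemma flag_subS i : (i < l)%N -> (X i.+1 <= X i)%VS.
Proof. by case: flagX => _ _ _ h /h/andP[]. Qed.

Lemma full_nsub H : H \in A -> ~~ (X 0 <= H)%VS.
Proof.
case: flagX => -> _ _ _ /arr_hyperplane hH; apply/negP => /dimvS.
by rewrite dim_rV leqNgt (eq_leq (eqP hH)).
Qed.

Lemma count_unique (T : eqType) (s : seq T) (P : pred T) x : uniq s ->
  (forall y, y \in s -> P y = (y == x)) -> count P s = (x \in s).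
Proof. by move=> us eqP; rewrite -(count_uniq_mem _ us); apply: eq_in_count. Qed.

Lemma iter_restr_carrier i : (i <= l)%N ->
  let B := iter_restr A X i in
  uniq B.1 /\ forall Z, Z \in B.1 <->
    exists2 H, H \in A & ~~ (X i <= H)%VS /\ Z = (X i :&: H)%VS.
Proof.
elim: i => [_|i IHi lt_il] /=.
  split=> [|Z]; first by case/andP: arrA.
  have X0 : X 0 = fullv by case: flagX.
  split=> [AZ|[H AH [_ ->]]]; last by rewrite X0 capfv.
  by exists Z; rewrite // full_nsub // X0 capfv.
case: (iter_restr A X i) (IHi (ltnW lt_il)) => B m /= [uB memB].
split=> [|Z]; first exact: undup_uniq.
rewrite mem_undup; split=> [/mapP[Z']|[H AH [nH ->]]].
  rewrite mem_filter => /andP[nZ' /memB[H AH [nH def_Z']]] ->.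
  exists H => //; rewrite def_Z' capvA (capv_idPl (flag_subS lt_il)).
  by rewrite def_Z' subv_cap flag_subS in nZ'.
apply/mapP; exists (X i :&: H)%VS; last by rewrite capvA (capv_idPl (flag_subS lt_il)).
rewrite mem_filter subv_cap flag_subS //= nH; apply/memB; exists H => //.
by split=> //; apply: contra nH; apply: subv_trans (flag_subS lt_il).
Qed.

Lemma restr_count i H Y : (i < l)%N -> H \in A -> ~~ (X i <= H)%VS ->
  (Y <= X i)%VS -> (\dim Y).+1 = \dim (X i) -> (Y <= H)%VS = (Y == X i :&: H)%VS.
Proof.
move=> lt_il AH nH sYX dimY; apply/idP/eqP => [sYH|->]; last exact: capvSr.
exact: hyperplane_cap_eq (arr_hyperplane AH) _ _ _ _.
Qed.

(** Double counting, from i to i + 1: an H not containing X_i is counted in the single member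
    [X i :&: H] of the previous restriction, which differs from X_{i+1} exactly when H does not
    contain X_{i+1}. For i = 0 the multiplicity is constantly 1, which is the count for members of
    A. *)
Lemma iter_restr_mult i Y : (i < l)%N -> (Y <= X i)%VS -> (0 < i)%N || (Y \in A) ->
  (iter_restr A X i).2 Y = count (fun H => (Y <= H)%VS && ~~ (X i <= H)%VS) A.
Proof.
elim: i Y => [|i IHi] Y lt_il sYX /=.
  move=> AY; rewrite (count_unique (x := Y)) ?AY //; first by case/andP: arrA.
  move=> H AH; rewrite full_nsub // andbT eq_sym; apply/idP/eqP => [|-> //].
  by apply: hyperplane_eq; apply: arr_hyperplane.
have lt_il' := ltnW lt_il => _.
have [uB memB] := iter_restr_carrier (ltnW lt_il').
have IH Z : Z \in (iter_restr A X i).1 -> (iter_restr A X i).2 Z =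
    count (fun H => (Z <= H)%VS && ~~ (X i <= H)%VS) A.
  move=> BZ; apply: IHi => //; first by case/memB: BZ => H _ [_ ->]; apply: capvSl.
  by case: (i) BZ => //= ->.
case: (iter_restr A X i) uB memB IH => B m /= uB memB IH.
rewrite big_seq_cond (eq_bigr _ (fun Z PZ => IH Z (proj1 (andP PZ)))) -big_seq_cond.
under eq_bigr do rewrite -sum1_count big_mkcond.
rewrite exchange_big /= -sum1_count [RHS]big_mkcond big_seq [RHS]big_seq.
apply: eq_bigr => H AH; rewrite -big_mkcondr sum1_count /=.
have [sXH|nXH] := boolP (X i <= H)%VS.
  rewrite (subv_trans (flag_subS lt_il') sXH) andbF.
  by apply/eqP; rewrite -leqn0 leqNgt -has_count; apply/hasPn => Z _; rewrite !andbF.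
have dimS := flag_dimS lt_il'.
rewrite (eq_in_count (a2 := fun Z => (Z == X i :&: H)%VS && ((Y <= H)%VS && ~~ (X i.+1 <= H)%VS))).
  have [_|_] := boolP (_ && _); last first.
    by apply/eqP; rewrite -leqn0 leqNgt -has_count; apply/hasPn => Z _; rewrite andbF.
  rewrite (eq_count (a2 := pred1 (X i :&: H)%VS)) => [|Z /=]; last by rewrite andbT.
  have BH : (X i :&: H)%VS \in B by apply/memB; exists H.
  by rewrite (count_uniq_mem _ uB) BH.
move=> Z BZ; have [H' AH' [nH' def_Z]] := (memB Z).1 BZ.
have sZX : (Z <= X i)%VS by rewrite def_Z capvSl.
have dimZ : (\dim Z).+1 = \dim (X i) by rewrite def_Z dim_cap_hyperplane ?arr_hyperplane.
rewrite andbT (restr_count lt_il' AH) // andbC; have [->|//] := eqVneq Z _.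
rewrite subv_cap (subv_trans sYX (flag_subS lt_il')) /=; congr (_ && ~~ _).
by rewrite eq_sym -restr_count // flag_subS.
Qed.

(** Every H not containing X_i contributes at least once, at [X i :&: H]; heaviness is exploited
    through this lower bound. *)
Lemma restr_total i : (0 < i < l)%N ->
  (count (fun H => ~~ (X i <= H)%VS) A <= mult_total (iter_restr A X i))%N.
Proof.
case/andP=> i_gt0 lt_il; have [uB memB] := iter_restr_carrier (ltnW lt_il).
rewrite /mult_total big_seq.
have sBX Z : Z \in (iter_restr A X i).1 -> (Z <= X i)%VS.
  by case/memB => H _ [_ ->]; apply: capvSl.
rewrite (eq_bigr _ (fun Z BZ => iter_restr_mult lt_il (sBX Z BZ) (introT orP (or_introl i_gt0)))).
rewrite -big_seq; under eq_bigr do rewrite -sum1_count big_mkcond.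
rewrite exchange_big /= -sum1_count big_mkcond big_seq [X in (_ <= X)%N]big_seq.
apply: leq_sum => H AH; case: ifP => // nXH.
have BH : (X i :&: H)%VS \in (iter_restr A X i).1 by apply/memB; exists H.
by rewrite (big_rem _ BH) /= capvSr.
Qed.

End Restrictions.

(** * Normalized forms, and vectors spanning the flag *)

Lemma below_scale (v : 'I_l -> V) j c a : c != 0 -> below v j (c *: a) = below v j a.
Proof.
move=> nz_c; apply: eq_forallb => k.
by rewrite dotZl mulf_eq0 (negbTE nz_c).
Qed.

(** Divide a defining form by its value at v_j, where j is its level; a form has at most one level,
    so one scaling serves all j. *)
Lemma normalized_form (v : 'I_l -> V) H : is_hyperplane H -> exists a,
  [/\ a != 0, kerform a = H
    & forall j : 'I_l, below v j.+1 a -> ~~ below v j a -> dot a (v j) = 1].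
Proof.
case/hyperplane_form => a nz_a def_H.
case: (pickP (fun j : 'I_l => below v j.+1 a && ~~ below v j a)) => [j|no_j]; last first.
  by exists a; split=> // j b1 b0; have := no_j j; rewrite b1 b0.
case/andP=> bSj nbj; have nz_c : dot a (v j) != 0.
  apply: contra nbj => /eqP a0; apply/belowP => k; rewrite leq_eqVlt.
  by case/predU1P => [/val_inj <- //|]; apply/(belowP _ _ _ bSj).
have nz_ci : (dot a (v j))^-1 != 0 by rewrite invr_neq0.
exists ((dot a (v j))^-1 *: a); split.
- by rewrite scaler_eq0 negb_or nz_ci.
- by rewrite kerformZ.
move=> k; rewrite !below_scale // => bSk nbk.
have [lt_kj|lt_jk|eq_kj] := ltngtP k j.
- by rewrite (below_le lt_kj bSk) in nbj.
- by rewrite (below_le lt_jk bSj) in nbk.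
- by rewrite (val_inj eq_kj) dotZl mulVf.
Qed.

Lemma normalized_forms (v : 'I_l -> V) A : all (@is_hyperplane K l) A ->
  exists2 F, A = [seq kerform a | a <- F] & forall a, a \in F ->
    a != 0 /\ forall j : 'I_l, below v j.+1 a -> ~~ below v j a -> dot a (v j) = 1.
Proof.
elim: A => [|H A IHA] /=; first by exists [::].
case/andP=> /(normalized_form v)[a [nz_a <- norm_a]] /IHA[F -> norm_F].
by exists (a :: F) => // b /predU1P[->|/norm_F].
Qed.

Lemma kerform_simple F :
  uniq [seq kerform a | a <- F] -> (forall a, a \in F -> a != 0) -> simple_forms F.
Proof.
move=> uF nzF; split=> //; first exact: map_uniq uF.
move=> a b Fa Fb /sub_rVP[c def_b].
have nz_c : c != 0 by apply: contraNneq (nzF b Fb) => c0; rewrite def_b c0 scale0r.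
have eq_ker : kerform b = kerform a by rewrite def_b kerformZ.
elim: F uF Fa Fb {nzF def_b} => //= d F IHF /andP[nFd uF].
rewrite !inE => /predU1P[eq_a|Fa] /predU1P[eq_b|Fb].
- by rewrite eq_a eq_b.
- by case/negP: nFd; rewrite -eq_a -eq_ker map_f.
- by case/negP: nFd; rewrite -eq_b eq_ker map_f.
- exact: IHF.
Qed.

(** [in_D] tests every form with kernel H, [logder] only the chosen one; forms with the same kernel
    are proportional. *)
Lemma in_D_logder F (phi : 'I_l -> S) : (forall a, a \in F -> a != 0) ->
  in_D [seq kerform a | a <- F] phi <-> logder F (\row_j phi j).
Proof.
move=> nzF; have derE a : der_apply phi a = der (\row_j phi j) a.
  by rewrite -der_applyE; apply: eq_bigr => j _; rewrite mxE.
split=> [Dphi a Fa|Dphi _ /mapP[a Fa ->] b eq_ker].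
  by rewrite -derE; apply: (Dphi (kerform a)); rewrite ?map_f.
have [c def_b] : exists c, b = c *: a.
  by apply: kerform_sub; rewrite ?nzF ?eq_ker.
have [nz_c|c0] := eqVneq c 0; last first.
  have [g def_g] := Dphi a Fa; exists g.
  by rewrite derE def_b derZ def_g linearZ /= -mul_mpolyC mulrA.
by exists 0; rewrite derE def_b nz_c scale0r mulr0 /der /cst map_mx0 trmx0 mulmx0 mxE.
Qed.

Lemma free_saito F (d : 'I_l -> nat) : simple_forms F -> (\sum_i d i)%N = size F ->
  free_with_exp [seq kerform a | a <- F] d <->
  exists2 M : 'M[S]_l, saito F M & forall i k, M i k \is (d i).-homog.
Proof.
move=> sF sum_d; have nzF : forall a, a \in F -> a != 0 by case: sF.
split=> [[theta [Dtheta homth spanth indepth]]|[M sM hM]].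
  pose M : 'M[S]_l := \matrix_(i, j) theta i j.
  have hM i k : M i k \is (d i).-homog by rewrite mxE; apply: homth.
  exists M => //; apply: (homog_basis_saito (d := d)) => // [i|t tM0].
    have /(in_D_logder _ nzF) := Dtheta i.
    by congr (logder F _); apply/rowP => j; rewrite !mxE.
  apply/rowP => i; rewrite mxE; apply: (indepth (fun i => t 0 i)) => j.
  have := congr1 (fun r : 'rV[S]_l => r 0 j) tM0; rewrite !mxE => eq0.
  by rewrite -[RHS]eq0; apply: eq_bigr => k _; rewrite mxE.
exists (fun i j => M i j); split=> // [i|phi /(in_D_logder _ nzF) Dphi|f f0 i].
- apply/(in_D_logder _ nzF); have [logM _] := sM.
  by have := logM i; congr (logder F _); apply/rowP => j; rewrite !mxE.
- have [u def_u] := saito_span sF sM Dphi; exists (fun i => u 0 i) => j.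
  by have := congr1 (fun r : 'rV[S]_l => r 0 j) def_u; rewrite !mxE.
- have fM0 : (\row_i f i) *m M = 0.
    apply/rowP => j; rewrite !mxE -[RHS](f0 j).
    by apply: eq_bigr => k _; rewrite mxE.
  by have := congr1 (fun r : 'rV[S]_l => r 0 i) (saito_indep sF sM fM0); rewrite !mxE.
Qed.

Section FlagVectors.
Variables (A : seq {vspace V}) (X : nat -> {vspace V}) (v : 'I_l -> V).
Hypothesis flagX : is_flag A X.
Hypothesis v_flag : forall i : 'I_l, v i \in X i /\ v i \notin X i.+1.

Lemma flag_mono i j : (i <= j <= l)%N -> (X j <= X i)%VS.
Proof.
case/andP=> le_ij le_jl; elim: j le_ij le_jl => [|j IHj].
  by rewrite leqn0 => /eqP ->.
rewrite leq_eqVlt ltnS => /predU1P[-> //|le_ij] lt_jl.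
exact: subv_trans (flag_subS flagX lt_jl) (IHj le_ij (ltnW lt_jl)).
Qed.

Lemma flag_step (i : 'I_l) : X i = (X i.+1 + <[v i]>)%VS.
Proof.
have [Xi nXi] := v_flag i; apply/esym/eqP; rewrite eqEdim subv_add -memvE Xi.
rewrite (flag_subS flagX) //= -(flag_dimS flagX) // ltn_neqAle dimvS ?addvSl // andbT.
rewrite (dimv_leqif_sup (addvSl _ _)); apply: contra nXi; rewrite subv_add -memvE.
by case/andP.
Qed.

(** X_j is X_{j+1} plus the line of v_j, so going down from X_l = 0 it is spanned by the v_k with k
    >= j. *)
Lemma below_flag j a : (j <= l)%N -> below v j a = (X j <= kerform a)%VS.
Proof.
move=> le_jl; apply/idP/idP => [|sXa]; last first.
  apply/belowP => k le_jk; rewrite dotC; apply/eqP; rewrite -mem_kerform.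
  have le_jkl : (j <= k <= l)%N by rewrite le_jk ltnW.
  by have [Xk _] := v_flag k; apply: (subvP (subv_trans (flag_mono le_jkl) sXa)).
rewrite -(subKn le_jl); elim: (l - j)%N (leq_subr j l) => [_ _|m IHm lt_ml].
  by rewrite subn0; case: flagX => _ -> _ _; rewrite sub0v.
have lt_jl : (l - m.+1 < l)%N by rewrite ltn_subrL (leq_trans _ lt_ml).
move=> ba; rewrite (flag_step (Ordinal lt_jl)) subv_add /= subnSK // -memvE mem_kerform.
rewrite IHm ?(ltnW lt_ml) //; last by apply: below_le ba; rewrite leq_sub2l.
by move/belowP: ba => /(_ (Ordinal lt_jl)) ba; rewrite dotC ba ?eqxx.
Qed.

Lemma flag_det : \det (\matrix_i v i) != 0.
Proof.
apply/det0P => -[u nz_u uv0]; have /rV0Pn[i0 nz_i0] := nz_u.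
(* The smallest index with nonzero coefficient in a linear relation would put v_i in X_{i+1}. *)
case: (@arg_minnP _ i0 (fun i => u 0 i != 0) val nz_i0) => i nz_ui min_i.
have [_ /negP] := v_flag i; apply.
have : \sum_k u 0 k *: v k = 0.
  rewrite -[RHS]uv0 mulmx_sum_row; apply: eq_bigr => k _.
  by rewrite rowK.
rewrite (bigD1 i) //= => /eqP; rewrite addr_eq0 => /eqP eq_ui.
rewrite -[v i](scalerK nz_ui) eq_ui; apply: memvZ; rewrite memvN.
apply: memv_suml => k ne_ki; have [->|nz_uk] := eqVneq (u 0 k) 0.
  by rewrite scale0r mem0v.
have lt_ik : (i < k)%N.
  by rewrite ltn_neqAle min_i // andbT -(inj_eq val_inj) eq_sym in ne_ki *.
have le_ikl : (i.+1 <= k <= l)%N by rewrite lt_ik ltnW.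
by have [Xk _] := v_flag k; apply: memvZ; apply: (subvP (flag_mono le_ikl)).
Qed.

End FlagVectors.

Definition lev (v : 'I_l -> V) a := find (fun j => below v j.+1 a) (iota 0 l).

Lemma lev_below (v : 'I_l -> V) a : \det (\matrix_i v i) != 0 -> a != 0 ->
  (lev v a < l)%N /\ forall j, below v j a = (lev v a < j)%N.
Proof.
move=> free_v nz_a; pose p j := below v j.+1 a.
have nb0 : ~~ below v 0 a by apply: contra nz_a => /(below0 free_v) ->.
have l_gt0 : (0 < l)%N.
  by rewrite lt0n; apply: contra nb0 => /eqP l0; apply/belowP => k; have := ltn_ord k;
    rewrite [X in (_ < X)%N]l0.
have has_p : has p (iota 0 l).
  apply/hasP; exists l.-1; first by rewrite mem_iota ltn_predL l_gt0.
  apply/belowP => k; rewrite prednK // => /(leq_trans (ltn_ord k)).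
  by rewrite ltnn.
have lt_lev : (lev v a < l)%N by rewrite has_find size_iota in has_p.
have b_lev : below v (lev v a).+1 a.
  by have := nth_find 0 has_p; rewrite nth_iota.
split=> // j; apply/idP/idP => [bj|/below_le]; last exact.
rewrite ltnNge; apply/negP => le_j.
case: (posnP j) => [j0|j_gt0]; first by rewrite -j0 bj in nb0.
have lt_j : (j.-1 < lev v a)%N by rewrite prednK.
have := before_find 0 lt_j; rewrite nth_iota; last exact: ltn_trans lt_lev.
by rewrite add0n prednK // bj.
Qed.

Lemma sum_count_eq (T : eqType) (s : seq T) (f : T -> nat) m n :
  (forall x, x \in s -> f x < n)%N ->
  (\sum_(m <= j < n) count (fun x => f x == j) s = count (fun x => m <= f x) s)%N.
Proof.
move=> ltf; under eq_bigr do rewrite -sum1_count big_mkcond.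
rewrite exchange_big /= -sum1_count [RHS]big_mkcond big_seq [RHS]big_seq.
apply: eq_bigr => x s_x.
rewrite -big_mkcond (eq_bigl (fun j => j == f x)) => [|j]; last by rewrite eq_sym.
by rewrite big_nat1_eq ltf // andbT.
Qed.

Lemma constant_eq (T : eqType) (s : seq T) x y :
  constant s -> x \in s -> y \in s -> x = y.
Proof.
case: s => //= z s /all_pred1P ->.
by rewrite !inE !mem_nseq => /predU1P[->|/andP[_ /eqP ->]]
  /predU1P[->|/andP[_ /eqP ->]].
Qed.

(** * Counting pairs of hyperplanes *)

Section Counting.
Variables (F : seq V) (X : nat -> {vspace V}) (v : 'I_l -> V).
Local Notation A := [seq kerform a | a <- F].
Hypothesis arrA : is_arrangement A.
Hypothesis flagX : is_flag A X.
Hypothesis v_flag : forall i : 'I_l, v i \in X i /\ v i \notin X i.+1.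
Hypothesis normF : forall a, a \in F ->
  a != 0 /\ forall j : 'I_l, below v j.+1 a -> ~~ below v j a -> dot a (v j) = 1.

Lemma F_neq0 a : a \in F -> a != 0. Proof. by case/normF. Qed.

Lemma F_simple : simple_forms F.
Proof. by apply: kerform_simple F_neq0; case/andP: arrA. Qed.

Lemma F_adapted : adapted v F.
Proof.
split; [exact: F_simple | exact: flag_det flagX v_flag | move=> a j].
by rewrite mem_filter => /andP[/andP[bSj nbj] /normF[_]]; apply.
Qed.

Lemma F_kerform_inj a b : a \in F -> b \in F ->
  (kerform a <= kerform b)%VS -> b = a.
Proof.
move=> Fa Fb /(kerform_sub (F_neq0 Fa))[c def_b]; have [_ _ prF] := F_simple.
by apply: prF => //; rewrite def_b scalemx_sub.
Qed.

Lemma F_lev_lt a : a \in F -> (lev v a < l)%N.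
Proof. by move/F_neq0/(lev_below (flag_det flagX v_flag)) => []. Qed.

Lemma F_below j a : a \in F -> below v j a = (lev v a < j)%N.
Proof. by move/F_neq0/(lev_below (flag_det flagX v_flag)) => []. Qed.

Lemma F_flag j a : a \in F -> (j <= l)%N -> (X j <= kerform a)%VS = (lev v a < j)%N.
Proof. by move=> Fa le_jl; rewrite -(below_flag flagX v_flag) // F_below. Qed.

Lemma level_lev j : level v F j = [seq a <- F | lev v a == j].
Proof.
apply: eq_in_filter => a Fa; rewrite !F_below // ltnS -leqNgt.
by rewrite eqn_leq.
Qed.

Lemma size_level j : size (level v F j) = count (fun a => lev v a == j) F.
Proof. by rewrite level_lev size_filter. Qed.

Lemma sum_level_size : (\sum_(i < l) size (level v F i))%N = size F.
Proof.
rewrite -(big_mkord xpredT (fun i => size (level v F i))).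
under eq_bigr do rewrite size_level.
rewrite (sum_count_eq _ F_lev_lt); apply/eqP; rewrite -all_count; apply/allP => a _.
exact: leq0n.
Qed.

Lemma count_flag i j : (i <= l)%N -> (j <= l)%N ->
  count (fun H => (X j <= H)%VS && ~~ (X i <= H)%VS) A
  = count (fun a => i <= lev v a < j)%N F.
Proof.
move=> le_il le_jl; rewrite count_map; apply: eq_in_count => a Fa /=.
by rewrite !F_flag // -leqNgt andbC.
Qed.

(** X_{i+1} is an intersection of members of A; if all those containing it also contained X_i, the
    two would coincide. *)
Lemma level_pos i : (i < l)%N -> (0 < size (level v F i))%N.
Proof.
move=> lt_il; rewrite size_level -has_count.
have -> : has (fun a => lev v a == i) F = has (fun a => i <= lev v a < i.+1)%N F.
  by apply: eq_has => a; rewrite ltnS -eqn_leq eq_sym.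
rewrite has_count -count_flag ?(ltnW lt_il) // -has_count.
apply: contraT => /hasPn noH; have [_ _ XL XS] := flagX.
have /andP[sub_X neq_X] := XS i lt_il.
case/eqP: neq_X; apply/eqP; rewrite eqEsubv sub_X /=.
apply: Lk_sub (XL i.+1 lt_il) _ => H AH sXH.
by apply: contraR (noH H AH) => nXH; rewrite sXH.
Qed.

Lemma level_first : (0 < l)%N -> size (level v F 0) = 1%N.
Proof.
move=> l_gt0; have lev0 a : a \in level v F 0 -> a \in F /\ kerform a = X 1.
  rewrite level_lev mem_filter => /andP[/eqP lev_a Fa]; split=> //; apply/esym.
  apply/eqP; rewrite eqEdim F_flag // lev_a /= -ltnS (flag_dimS flagX) //.
  by rewrite (flag_dim flagX) // subn0 (eq_leq (eqP (kerform_hyperplane (F_neq0 Fa)))).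
have uL : uniq (level v F 0) by rewrite filter_uniq //; case: F_simple.
have := level_pos l_gt0; case: (level v F 0) lev0 uL => // a [|b s] lev0 //=.
rewrite inE negb_or => /andP[/andP[/eqP neq_ab _] _] _; case: neq_ab.
have [Fa Xa] := lev0 a (mem_head _ _).
have [|Fb Xb] := lev0 b; first by rewrite !inE eqxx orbT.
by apply/esym/F_kerform_inj; rewrite ?Xa ?Xb.
Qed.

Lemma mult_level i : (i < l)%N ->
  (iter_restr A X i).2 (X i.+1) = size (level v F i).
Proof.
move=> lt_il; have [i0|i_gt0] := posnP i.
  by move: lt_il; rewrite i0 /= => /level_first ->.
rewrite (iter_restr_mult arrA flagX) ?i_gt0 ?(flag_subS flagX) //.
rewrite count_flag ?(ltnW lt_il) // size_level; apply: eq_count => a.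
by rewrite ltnS -eqn_leq eq_sym.
Qed.

(** Heaviness gives 2 n_i >= n_i + n_{i+1} + ..., the number of hyperplanes of level at least i. *)
Lemma heavy_level_decr i : (0 < i)%N -> (i.+1 < l)%N ->
  heavy (iter_restr A X i) (X i.+1) ->
  (size (level v F i.+1) <= size (level v F i))%N.
Proof.
move=> i_gt0 lt_il; have lt_il' := ltnW lt_il.
rewrite /heavy mult_level // => /(leq_trans (restr_total arrA flagX (i := i) _)).
rewrite i_gt0 lt_il' => /(_ isT); rewrite count_map mul2n -addnn.
have -> : count (preim (@kerform K l) (fun H => ~~ (X i <= H)%VS)) F
    = count (fun a => i <= lev v a)%N F.
  by apply: eq_in_count => a Fa /=; rewrite F_flag ?(ltnW lt_il') // -leqNgt.
move=> le2; rewrite -(leq_add2l (size (level v F i))); apply: leq_trans le2.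
rewrite !size_level -count_predUI [X in (_ + X)%N](_ : _ = 0%N) ?addn0.
  by apply: sub_count => a /= /orP[] /eqP ->.
apply/eqP; rewrite -leqn0 leqNgt -has_count; apply/hasPn => a _ /=.
by apply/negP => /andP[/eqP ->]; rewrite ltn_eqF.
Qed.

Definition through F Y := [seq a <- F | (Y <= kerform a)%VS].

Definition ascents Y :=
  (\sum_(b <- through F Y) count (fun a => lev v a < lev v b)%N (through F Y))%N.

(** The obstruction to modularity: two hyperplanes of one level whose intersection lies in no
    hyperplane of another level. *)
Definition flat Y :=
  (1 < size (through F Y))%N && constant [seq lev v a | a <- through F Y].

Lemma mem_through Y a : (a \in through F Y) = (Y <= kerform a)%VS && (a \in F).
Proof. by rewrite mem_filter. Qed.

Lemma codim2_eq Y a b : Y \in Lk 2 A -> a \in through F Y -> b \in through F Y -> a != b ->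
  Y = (kerform a :&: kerform b)%VS.
Proof.
move=> LY; rewrite !mem_through => /andP[sYa Fa] /andP[sYb Fb] neq_ab.
have hyp c : c \in F -> is_hyperplane (kerform c) by move/F_neq0/kerform_hyperplane.
have nab : ~~ (kerform a <= kerform b)%VS.
  by apply: contra neq_ab => sab; apply/eqP/esym/F_kerform_inj.
apply: hyperplane_cap_eq => //; first exact: hyp.
have := dim_cap_hyperplane (hyp b Fb) nab; have := eqP (hyp a Fa).
by move=> dima dimab; rewrite (Lk_dim LY) -dimab -(congr1 (subn^~ 2) dima) subn2 /= -dimab.
Qed.

(** Otherwise Y would be the intersection of the two lower hyperplanes and contain X_k for k the
    level of b; then b would vanish on X_k. *)
Lemma ascent_unique Y a1 a2 b : Y \in Lk 2 A ->
    a1 \in through F Y -> a2 \in through F Y -> b \in through F Y ->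
    (lev v a1 < lev v b)%N -> (lev v a2 < lev v b)%N -> a1 = a2.
Proof.
move=> LY Y1 Y2; rewrite mem_through => /andP[sYb Fb] lt1 lt2; apply/eqP.
apply: contraT => /(codim2_eq LY Y1 Y2) def_Y.
have le_l := ltnW (F_lev_lt Fb).
move: Y1 Y2; rewrite !mem_through => /andP[_ F1] /andP[_ F2].
rewrite -(ltnn (lev v b)) -(F_flag Fb le_l); apply: subv_trans sYb.
by rewrite def_Y subv_cap !F_flag ?lt1.
Qed.

(** If levels vary along Y, a single form attains the minimum, and each other form ascends from it
    and from nothing else. If they do not vary there are no ascents, in agreement with [size - 1]
    when at most one form is present. *)
Lemma ascentsE Y : Y \in Lk 2 A ->
  ascents Y = if flat Y then 0%N else (size (through F Y) - 1)%N.
Proof.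
move=> LY; rewrite /flat /ascents.
have uY : uniq (through F Y) by rewrite filter_uniq //; case: F_simple.
have [cY|ncY] := boolP (constant [seq lev v a | a <- through F Y]).
  transitivity 0%N; last by rewrite andbT; case: ltnP => // /eqP.
  rewrite big_seq big1 // => b Yb; apply/eqP; rewrite -leqn0 leqNgt -has_count.
  apply/hasPn => a Ya; rewrite -leqNgt; apply: eq_leq.
  by apply: (constant_eq cY); apply: map_f.
rewrite andbF; have [b0 Yb0 min_b0] : exists2 b0, b0 \in through F Y &
    forall a, a \in through F Y -> (lev v b0 <= lev v a)%N.
  have: exists n, has (fun a => lev v a == n) (through F Y).
    case: (through F Y) ncY => // a s _; exists (lev v a); rewrite /= eqxx //.
  case/ex_minnP => n /hasP[b0 Yb0 /eqP lev_b0] min_n; exists b0 => // a Ya.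
  by rewrite lev_b0 min_n //; apply/hasP; exists a.
have [b1 Yb1 lt_b01] : exists2 b1, b1 \in through F Y & (lev v b0 < lev v b1)%N.
  apply/hasP; apply: contraR ncY => /hasPn le_b0.
  have all_b0 : all (pred1 (lev v b0)) [seq lev v a | a <- through F Y].
    rewrite all_map; apply/allP => a Ya /=.
    by rewrite eqn_leq leqNgt le_b0 // min_b0.
  by rewrite (all_pred1P _ _ all_b0) constant_nseq.
have only_b0 b : b \in through F Y -> b != b0 -> (lev v b0 < lev v b)%N.
  move=> Yb; apply: contraR; rewrite -leqNgt => /leq_ltn_trans/(_ lt_b01) lt_b1.
  by rewrite (ascent_unique LY Yb Yb0 Yb1).
rewrite (big_rem b0) //= [count _ _](_ : _ = 0%N) ?add0n; last first.
  apply/eqP; rewrite -leqn0 leqNgt -has_count; apply/hasPn => a Ya.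
  by rewrite -leqNgt min_b0.
rewrite subn1 -(size_rem Yb0) -sum1_size [LHS]big_seq [RHS]big_seq.
apply: eq_bigr => b; rewrite mem_rem_uniq // inE => /andP[neq_b Yb].
rewrite (count_unique (x := b0)) ?Yb0 // => a Ya; apply/idP/eqP => [lt_ab|->].
  by apply: (ascent_unique LY Ya Yb0 Yb lt_ab); apply: only_b0.
exact: only_b0.
Qed.

(** Two distinct hyperplanes pass together through exactly one Y, their intersection. *)
Lemma sum_ascents : (\sum_(Y <- Lk 2 A) ascents Y
  = \sum_(b <- F) count (fun a => lev v a < lev v b) F)%N.
Proof.
pose c Y a b := [&& (Y <= kerform a)%VS, (Y <= kerform b)%VS & (lev v a < lev v b)%N].
transitivity (\sum_(Y <- Lk 2 A) \sum_(b <- F) \sum_(a <- F) c Y a b)%N.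
  apply: eq_bigr => Y _; rewrite /ascents big_filter big_mkcond; apply: eq_bigr => b _.
  case: ifP => [sYb|nYb]; last by rewrite big1 // => a _; rewrite /c nYb andbF.
  rewrite count_filter -sum1_count big_mkcond; apply: eq_bigr => a _.
  by rewrite /c sYb /= andbC; case: (_ && _).
rewrite exchange_big /= big_seq [RHS]big_seq; apply: eq_bigr => b Fb.
rewrite exchange_big /= -sum1_count [RHS]big_mkcond big_seq [RHS]big_seq.
apply: eq_bigr => a Fa; rewrite -big_mkcond sum1_count /c.
case: ifP => lt_ab; last first.
  by apply/eqP; rewrite -leqn0 leqNgt -has_count; apply/hasPn => Y _; rewrite !andbF.
have neq_ab : a != b by apply: contraTneq lt_ab => ->; rewrite ltnn.
rewrite (count_unique (x := (kerform a :&: kerform b)%VS)) ?undup_uniq //.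
  rewrite cap_Lk2 ?map_f //; apply: contra neq_ab => /eqP eq_ker.
  by rewrite (F_kerform_inj Fa Fb) // eq_ker.
move=> Y LY; rewrite andbT; apply/andP/eqP => [[sYa sYb]|->].
  by apply: codim2_eq; rewrite // mem_through ?sYa ?sYb.
by rewrite capvSl capvSr.
Qed.

Lemma sum_products : (\sum_(b <- F) count (fun a => lev v a < lev v b) F
  = \sum_(0 <= i < l) \sum_(i.+1 <= j < l)
      size (level v F i) * size (level v F j))%N.
Proof.
transitivity (\sum_(0 <= i < l) size (level v F i) * count (fun a => i < lev v a) F)%N.
  transitivity (\sum_(a <- F) count (fun b => lev v a < lev v b) F)%N.
    under eq_bigr do rewrite -sum1_count big_mkcond.
    by rewrite exchange_big; apply: eq_bigr => a _; rewrite -sum1_count [RHS]big_mkcond.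
  under [RHS]eq_bigr do rewrite size_level -sum1_count big_distrl big_mkcond.
  rewrite exchange_big /= big_seq [RHS]big_seq; apply: eq_bigr => a Fa.
  rewrite -big_mkcond (eq_bigl (fun i => i == lev v a)) => [|i]; last by rewrite eq_sym.
  by rewrite big_nat1_eq F_lev_lt // mul1n.
apply: eq_bigr => i _; rewrite -big_distrr /=; congr (_ * _)%N.
by under [RHS]eq_bigr do rewrite size_level; rewrite (sum_count_eq _ F_lev_lt).
Qed.

(** The left side exceeds the right by the sum of |A_Y| - 1 over the flat Y, and each such term is
    positive. *)
Lemma b2_flat : b2 A = (\sum_(0 <= i < l) \sum_(i.+1 <= j < l)
      size (level v F i) * size (level v F j))%N
  <-> forall Y, Y \in Lk 2 A -> ~~ flat Y.
Proof.
have b2E : b2 A = (\sum_(Y <- Lk 2 A) (size (through F Y) - 1))%N.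
  by apply: eq_bigr => Y _; rewrite count_map size_filter.
rewrite b2E -sum_products -sum_ascents; split=> [eq_sum Y LY|nflat]; last first.
  by apply: eq_big_seq => Y LY; rewrite ascentsE // (negbTE (nflat Y LY)).
apply/negP => flatY; have := ascentsE LY; rewrite flatY => asc0.
have gt1 : (1 < size (through F Y))%N by case/andP: flatY.
move/eqP: eq_sum; rewrite !(big_rem Y LY) /= asc0 add0n gtn_eqF //.
apply: leq_ltn_trans (_ : (\sum_(Z <- rem Y (Lk 2 A)) (size (through F Z) - 1) < _)%N).
  rewrite [X in (X <= _)%N]big_seq [X in (_ <= X)%N]big_seq.
  apply: leq_sum => Z /mem_rem LZ.
  by rewrite ascentsE //; case: ifP.
by rewrite -[X in (X < _)%N]add0n ltn_add2r subn_gt0.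
Qed.

(** Modularity gives a lower form vanishing on Y, so Y is not flat. Conversely, a form d through Y
    of another level than j is lower, since Y contains X_{j+1}; it remains to see that d is
    proportional to b - a. *)
Lemma flat_modular : modular v F <-> forall Y, Y \in Lk 2 A -> ~~ flat Y.
Proof.
have nF : forall a (j : 'I_l), a \in level v F j -> dot a (v j) = 1.
  by case: F_adapted.
split=> [modF Y LY|nflat j a b La Lb neq_ba].
  apply/negP => /andP[gt1 cY].
  have uY : uniq (through F Y) by rewrite filter_uniq //; case: F_simple.
  have [a [b [Ya Yb neq_ba lev_ab]]] : exists a b, [/\ a \in through F Y, b \in through F Y,
      b != a & lev v b = lev v a].
    move: gt1 uY cY; case: (through F Y) => [|a [|b s]] //= _ /andP[nab _] /andP[/eqP eq_ab _].
    exists a, b; rewrite !inE !eqxx orbT; split=> //.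
    by apply: contraNneq nab => ->; apply: mem_head.
  have [[sYa Fa] [sYb Fb]] : ((Y <= kerform a)%VS /\ a \in F)
      /\ ((Y <= kerform b)%VS /\ b \in F).
    by move: Ya Yb; rewrite !mem_through => /andP[? ?] /andP[? ?].
  pose j := Ordinal (F_lev_lt Fa).
  have [|||d] := modF j a b; rewrite ?level_lev ?mem_filter ?Fa ?Fb ?lev_ab ?eqxx //.
  case/andP=> bd Fd [c def_c].
  have nz_c : c != 0.
    apply: contra neq_ba => /eqP c0; move/eqP: def_c.
    by rewrite c0 scale0r subr_eq0.
  have Yd : d \in through F Y.
    rewrite mem_through Fd andbT -(kerformZ d nz_c) -def_c; apply/subvP => x Yx.
    have := subvP sYa x Yx; have := subvP sYb x Yx.
    by rewrite !mem_kerform ![dot x _]dotC dotBl => /eqP -> /eqP ->; rewrite subrr.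
  have lev_d : lev v d = lev v a by apply: (constant_eq cY); apply: map_f.
  by move: bd; rewrite F_below // lev_d ltnn.
have [La' Lb'] := (La, Lb); move: La' Lb'.
rewrite level_lev !mem_filter => /andP[/eqP lev_a Fa] /andP[/eqP lev_b Fb].
have neq_ker : kerform a != kerform b.
  apply: contra neq_ba => /eqP eq_ker; apply/eqP/F_kerform_inj => //.
  by rewrite eq_ker.
pose Y := (kerform a :&: kerform b)%VS.
have LY : Y \in Lk 2 A by apply: cap_Lk2; rewrite ?map_f.
have Ya : a \in through F Y by rewrite mem_through Fa capvSl.
have Yb : b \in through F Y by rewrite mem_through Fb capvSr.
have [d Yd neq_d] : exists2 d, d \in through F Y & lev v d != j.
  apply/hasP; apply: contraR (nflat Y LY) => /hasPn lev_j.
  have all_j : all (pred1 (val j)) [seq lev v a | a <- through F Y].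
    by rewrite all_map; apply/allP => e /lev_j /=; rewrite negbK.
  rewrite /flat (all_pred1P _ _ all_j) constant_nseq andbT.
  have := uniq_leq_size (s1 := [:: a; b]) (s2 := through F Y); apply.
    by rewrite /= inE eq_sym neq_ba.
  by move=> e; rewrite !inE => /orP[] /eqP ->.
move: Yd; rewrite mem_through => /andP[sYd Fd].
have lt_dj : (lev v d < j)%N.
  rewrite ltn_neqAle neq_d -ltnS -(F_flag Fd) //; apply: subv_trans sYd.
  by rewrite subv_cap !F_flag // lev_a lev_b ltnS leqnn.
have Ld : d \in low v F j by rewrite mem_filter F_below // lt_dj.
have [c def_d] : exists c, d = c *: (b - a).
  apply: kerform_sub; first by rewrite subr_eq0.
  apply/subvP => x; rewrite !mem_kerform ![dot x _]dotC dotBl subr_eq0 => /eqP eq_x.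
  (* When a(x) = b(x), subtracting a(x) v_j moves x into Y, and d vanishes at v_j, so d(x) = 0. *)
  have : x - dot a x *: v j \in kerform d.
    apply: (subvP sYd); apply/memv_capP.
    rewrite !mem_kerform !dotBl !dotZl ![dot (v j) _]dotC !nF // !mulr1.
    by rewrite ![dot x _]dotC eq_x subrr eqxx.
  rewrite mem_kerform dotBl dotZl ![dot _ d]dotC.
  by rewrite (low_dot Ld) // mulr0 subr0.
have nz_c : c != 0 by apply: contraNneq (F_neq0 Fd) => c0; rewrite def_d c0 scale0r.
by exists d => //; exists c^-1; rewrite def_d scalerA mulVf ?scale1r.
Qed.

End Counting.

End LinearForms.

(** * Assembling the equivalence *)

Lemma flag_vectors (K : fieldType) (l : nat) (A : seq {vspace 'rV[K]_l})
    (X : nat -> {vspace 'rV[K]_l}) : is_flag A X ->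
  exists v : 'I_l -> 'rV[K]_l, forall i, v i \in X i /\ v i \notin X i.+1.
Proof.
case=> _ _ _ XS; have ex_u (i : 'I_l) : exists u, u \in X i /\ u \notin X i.+1.
  have /andP[sub_X neq_X] := XS i (ltn_ord i).
  have /subvPn[u Xu nXu] : ~~ (X i <= X i.+1)%VS.
    by apply: contra neq_X => sXX; rewrite eqEsubv sub_X.
  by exists u.
exact: fin_all_exists ex_u.
Qed.

Theorem theorem1p7 (K : fieldType) (l : nat) (A : seq {vspace 'rV[K]_l})
    (X : nat -> {vspace 'rV[K]_l}) :
  is_arrangement A ->
  is_flag A X ->
  (forall i, (1 <= i < l)%N -> heavy (iter_restr A X i) (X i.+1)) ->
  (free_with_exp A (fun i : 'I_l => (iter_restr A X i).2 (X i.+1))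
   <-> b2 A = (\sum_(0 <= i < l) \sum_(i.+1 <= j < l)
                 (iter_restr A X i).2 (X i.+1) * (iter_restr A X j).2 (X j.+1))%N).
Proof.
move=> arrA flagX heavyX; have [v v_flag] := flag_vectors flagX.
have [F def_A normF] := normalized_forms v (proj2 (andP arrA)).
rewrite {A}def_A in arrA flagX heavyX *.
have mult := mult_level arrA flagX v_flag normF.
have adF := F_adapted arrA flagX v_flag normF.
have sF := F_simple arrA normF.
have sum_mult : \sum_(0 <= i < l) \sum_(i.+1 <= j < l)
    (iter_restr [seq kerform a | a <- F] X i).2 (X i.+1)
      * (iter_restr [seq kerform a | a <- F] X j).2 (X j.+1)
    = \sum_(0 <= i < l) \sum_(i.+1 <= j < l)
        size (level v F i) * size (level v F j).
  apply: eq_big_nat => i /andP[_ lt_il]; apply: eq_big_nat => j /andP[_ lt_jl].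
  by rewrite !mult.
rewrite sum_mult (b2_flat arrA flagX v_flag normF).
(* The exponents sum to the number of hyperplanes because each hyperplane has exactly one level. *)
rewrite -(flat_modular arrA flagX v_flag normF) free_saito //; last first.
  by rewrite -(sum_level_size flagX v_flag normF); apply: eq_bigr => i _; apply: mult.
split=> [[M sM hM]|/(modular_saito adF)[M sM hM]]; last first.
  by exists M => // i k; rewrite mult.
have hM' i k : M i k \is ishomog1 (size (level v F i)) mdeg.
  by rewrite -(mult i (ltn_ord i)).
apply: (saito_modular adF _ _ _ sM hM') => [i i0|i|i j /andP[i_gt0 le_ij]].
- rewrite /level_size i0; apply: (level_first arrA flagX v_flag normF).
  exact: leq_ltn_trans (ltn_ord i).
- exact: (level_pos flagX v_flag normF).
rewrite /level_size; have := ltn_ord j; rewrite -(subnKC le_ij).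
(* Monotonicity from i to j chains heaviness over consecutive indices. *)
elim: (j - i) => [|m IHm]; first by rewrite addn0.
rewrite addnS => lt_l; apply: leq_trans (IHm (ltnW lt_l)).
apply: (heavy_level_decr arrA flagX v_flag normF) => //.
  exact: leq_trans (leq_addr _ _).
by apply: heavyX; rewrite (leq_trans i_gt0 (leq_addr _ _)) ltnW.
Qed.
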